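(* Let $k=k_0(T)$ be a rational function field over a perfect field $k_0$ of characteristic $p$, let $f(X)=X^{p^n}+a_{n-1}X^{p^{n-1}}+\cdots+a_1X^p+a_0X\in k_0[X]$, $a_0\neq 0$, be an additive polynomial all of whose roots lie in $k_0$, and let $K=k(y)$ be an elementary abelian $p$-extension of $k$, where $f(y)=u\in k$ and $F(X)=f(X)-u\in k[X]$ is irreducible of degree $p^n$. Then one can choose $u$ (that is, one can choose the generator $y$ with $K=k(y)$ and $f(y)=u\in k$) satisfying $$u=\sum_{i=1}^r\frac{Q_i(T)}{P_i(T)^{\alpha_i}}+R(T),$$ where $P_1,\ldots,P_r\in k_0[T]$ are distinct monic irreducible polynomials, $Q_1,\ldots,Q_r\in k_0[T]$ are such that $\gcd(Q_i,P_i)=1$, $\deg Q_i<\deg P_i^{\alpha_i}$, $\alpha_i=\lambda_ip^{m_i}>0$ with $0\leq m_i<n$ and $\gcd(\lambda_i,p)=1$ for $1\leq i\leq r$, and $R(T)\in k_0[T]$ is a polynomial such that: if $R(T)\notin k_0$, then $\deg R(T)=\lambda_0p^m>0$ with $\gcd(\lambda_0,p)=1$ and $0\leq m<n$; and if $R(T)\in k_0$, then either $R(T)=0$ or $R(T)\notin f(k_0)=\{f(\delta)\mid\delta\in k_0\}$. Furthermore, $P_1,\ldots,P_r$ are precisely the finite prime divisors of $k$ ramified in $K$, and $\mathcal{P}_\infty$ is ramified in $K$ if and only if $R(T)\notin k_0$.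
   Context: A polynomial $f$ is additive if $f(x+y)=f(x)+f(y)$ for all $x,y$ in an algebraic closure. $\mathcal{P}_\infty$ denotes the infinite prime of $k=k_0(T)$, i.e. the pole divisor of $T$; the finite prime divisors are identified with the monic irreducible polynomials of $k_0[T]$. *)

(* Defs.v *)
From HB Require Import structures.
From mathcomp Require Import all_boot all_order all_algebra.
From mathcomp Require Import all_fingroup all_solvable all_field.

Set Implicit Arguments.
Unset Strict Implicit.
Unset Printing Implicit Defensive.

Import Order.TTheory GRing.Theory Num.Theory.
Local Open Scope ring_scope.

Definition perfect_field (F : fieldType) : Prop :=
  forall q : {poly F}, irreducible_poly q -> separable_poly q.

(* [integralRange iota] makes the closed field [L] algebraic over [F]. *)
Definition additive_poly (F : fieldType) (f : {poly F}) : Prop :=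
  forall (L : closedFieldType) (iota : {rmorphism F -> L}),
    integralRange iota ->
    forall x y : L, (map_poly iota f).[x + y] =
                    (map_poly iota f).[x] + (map_poly iota f).[y].

(* All roots of [f] (in an algebraic closure) lie in [F]. *)
Definition splits (F : fieldType) (f : {poly F}) : Prop :=
  exists rs : seq F, f %= \prod_(z <- rs) ('X - z%:P).

Notation ratfun F := {fraction {poly F}}.

Notation "q %:F" := (@FracField.tofrac _ q) : ring_scope.

Definition rf_const (F : fieldType) (c : F) : ratfun F := c%:P%:F.

(* Normalized discrete valuations; the value at 0, conventionally +oo, is left
   unconstrained. *)
Definition discrete_valuation (L : fieldType) (v : L -> int) : Prop :=
  [/\ forall x y, x != 0 -> y != 0 -> v (x * y) = v x + v y,
      forall x y, x != 0 -> y != 0 -> x + y != 0 ->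
        Num.min (v x) (v y) <= v (x + y)
    & exists2 x, x != 0 & v x = 1].

Definition lies_above (F : fieldType) (L : fieldExtType F)
    (w : L -> int) (v : F -> int) (e : nat) : Prop :=
  forall x : F, x != 0 -> w x%:A = v x *+ e.

(* [v] is ramified in [L] when some prime of [L] above [v] has ramification
   index greater than 1. *)
Definition ramified (F : fieldType) (L : fieldExtType F) (v : F -> int) :
    Prop :=
  exists (w : L -> int) (e : nat),
    [/\ discrete_valuation w, lies_above w v e & (1 < e)%N].

(* The multiplicity of [P] in [q], for [P] nonconstant and [q] nonzero: then
   [P ^+ i %| q] forces [i < size q]. *)
Definition poly_ord (F : fieldType) (P q : {poly F}) : nat :=
  \max_(i < size q | P ^+ i %| q) nat_of_ord i.

(* [generic_quotient.repr x] is some fraction representing [x], with nonzero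
   denominator; the valuations below do not depend on which. *)
Definition rf_num (F : fieldType) (x : ratfun F) : {poly F} :=
  (frac (generic_quotient.repr x)).1.
Definition rf_den (F : fieldType) (x : ratfun F) : {poly F} :=
  (frac (generic_quotient.repr x)).2.

Definition finite_prime (F : fieldType) (P : {poly F}) (x : ratfun F) : int :=
  (poly_ord P (rf_num x))%:Z - (poly_ord P (rf_den x))%:Z.

(* deg (denominator) - deg (numerator), so that the pole of T has order 1. *)
Definition infinite_prime (F : fieldType) (x : ratfun F) : int :=
  (size (rf_den x))%:Z - (size (rf_num x))%:Z.

(* Main.v *)
Require Import Defs.
From HB Require Import structures.
From mathcomp Require Import all_boot all_order all_algebra.
From mathcomp Require Import all_fingroup all_solvable all_field.
From mathcomp Require Import zify ring.
From mathcomp Require boolp classical_sets.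


(** Replacing [y] by [z = y - h] changes [u] into [u - f(h)], because [f] is
    additive, and does not change [K].  So the first half of the theorem is
    about choosing [h].  A pole of [u] at [P] of order [b * p^n] is lowered by
    subtracting [f(M / P^b)], where [M^(p^n)] agrees modulo [P] with the leading
    numerator: such an [M] exists since the residue field at [P], finite over a
    perfect field, is perfect ([perfect_root_mod]).  The other terms of [f]
    contribute smaller poles, as [p^i < p^n].  Repeating this, and doing the same
    with the leading coefficient of the polynomial part, ends with pole orders
    [lambda * p^m], [m < n] ([normal_form]).

    For the second half let [w] be the new value of [f(z)] and [v] a valuation of
    [k] at a finite or infinite prime; [v] is trivial on [k0].

    If [w] is integral at [v], then [z] is a root of the monic integral
    polynomial [G = f(X) - w], whose derivative is a nonzero constant.  This
    forces every valuation of [K] above [v] to have ramification index 1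
    ([unramified_of_separable]).  The reason is that a uniformizer [pi] of [v]
    remains one in [K].  Take a monic integral [g] of least degree such that
    [g(z)] is in the maximal ideal.  By minimality [G = h g] modulo [pi], and
    separability makes [h(z)] a unit.  Any integral polynomial [c] with [c(z)] in
    the maximal ideal is divisible by [g] modulo [pi], so [h(z) c(z)] is a
    multiple of [pi].  No residue field or completion is involved.

    If [v(w) = - lambda * p^m], take a valuation [W] of [K] above [v], of index
    [e].  Then [z] has a pole, [f(z) = w] gives [p^n W(z) = - e lambda p^m], and
    [p] divides [e].  The existence of [W] is the general extension theorem for
    discrete valuations ([valuation_extension]): a maximal subring of [K]
    containing the valuation ring of [v], but not the inverse of a uniformizer,
    is a valuation ring by the classical argument with two relations for [x] and
    its inverse, and it is discrete because the degree is finite.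

    The two halves meet because the pole orders of a normal form can be read off
    its terms. *)

Set Implicit Arguments.
Unset Strict Implicit.
Unset Printing Implicit Defensive.

Import Order.TTheory GRing.Theory Num.Theory.
Local Open Scope ring_scope.

(** * Valuation rings *)

(** Bundling the proof lets the ring and its ideal below carry their closure
    structures without side conditions. *)
Record valuation (F : fieldType) := Valuation {
  valuation_fun :> F -> int;
  valuationP : discrete_valuation valuation_fun }.

(** A discrete valuation is unconstrained at 0, hence the separate clause for 0
    in the valuation ring and its maximal ideal. *)
Definition vring (F : fieldType) (v : valuation F) : {pred F} :=
  fun x => (x == 0) || (0 <= v x).

Definition vmax (F : fieldType) (v : valuation F) : {pred F} :=
  fun x => (x == 0) || (0 < v x).

Section Valuations.
Variables (F : fieldType) (v : valuation F).
Implicit Types x y : F.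

Lemma vringE x : (x \in vring v) = (x == 0) || (0 <= v x).
Proof. by []. Qed.

Lemma vmaxE x : (x \in vmax v) = (x == 0) || (0 < v x).
Proof. by []. Qed.

Lemma valM x y : x != 0 -> y != 0 -> v (x * y) = v x + v y.
Proof. by case: (valuationP v) => vM _ _; apply: vM. Qed.

Lemma val_min x y : x != 0 -> y != 0 -> x + y != 0 ->
  Num.min (v x) (v y) <= v (x + y).
Proof. by case: (valuationP v) => _ vD _; apply: vD. Qed.

Lemma uniformizer_exists : exists2 x, x != 0 & v x = 1.
Proof. by case: (valuationP v). Qed.

Lemma val1 : v 1 = 0.
Proof. by have := @valM 1 1 (oner_neq0 _) (oner_neq0 _); rewrite mulr1; lia. Qed.

Lemma valN x : v (- x) = v x.
Proof.
have [->|x0] := eqVneq x 0; first by rewrite oppr0.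
have N10 : -1 != 0 :> F by rewrite oppr_eq0 oner_neq0.
have vN1 : v (-1) = 0 by have := valM N10 N10; rewrite mulrNN mulr1 val1; lia.
by rewrite -mulN1r valM // vN1 add0r.
Qed.

Lemma valV x : x != 0 -> v x^-1 = - v x.
Proof. by move=> x0; have := valM x0 (invr_neq0 x0); rewrite divff // val1; lia. Qed.

Lemma valX x m : x != 0 -> v (x ^+ m) = v x *+ m.
Proof.
move=> x0; elim: m => [|m IH]; first by rewrite expr0 val1.
by rewrite exprS valM ?expf_neq0 // IH mulrS.
Qed.

Lemma vring_subring : subring_closed (vring v).
Proof.
split; first by rewrite vringE val1 lexx orbT.
  move=> x y; rewrite !vringE => /orP[/eqP->|vx] /orP[/eqP->|vy].
  - by rewrite subrr eqxx.
  - by rewrite sub0r valN vy orbT.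
  - by rewrite subr0 vx orbT.
  have [->|x0] := eqVneq x 0; first by rewrite sub0r valN vy orbT.
  have [->|y0] := eqVneq y 0; first by rewrite subr0 vx orbT.
  have [//|xy0] := eqVneq (x - y) 0.
  have := val_min x0 (_ : - y != 0) xy0; rewrite oppr_eq0 valN => /(_ y0).
  by apply: le_trans; rewrite le_min vx.
move=> x y; rewrite !vringE => /orP[/eqP->|vx] /orP[/eqP->|vy];
  rewrite ?mul0r ?mulr0 ?eqxx //.
have [->|x0] := eqVneq x 0; first by rewrite mul0r eqxx.
have [->|y0] := eqVneq y 0; first by rewrite mulr0 eqxx.
by rewrite valM // addr_ge0 ?orbT.
Qed.

Lemma vmax_zmod : zmod_closed (vmax v).
Proof.
split; first by rewrite vmaxE eqxx.
move=> x y; rewrite !vmaxE => /orP[/eqP->|vx] /orP[/eqP->|vy].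
- by rewrite subrr eqxx.
- by rewrite sub0r valN vy orbT.
- by rewrite subr0 vx orbT.
have [->|x0] := eqVneq x 0; first by rewrite sub0r valN vy orbT.
have [->|y0] := eqVneq y 0; first by rewrite subr0 vx orbT.
have [//|xy0] := eqVneq (x - y) 0.
have := val_min x0 (_ : - y != 0) xy0; rewrite oppr_eq0 valN => /(_ y0).
by apply: lt_le_trans; rewrite lt_min vx.
Qed.

End Valuations.

HB.instance Definition _ (F : fieldType) (v : valuation F) :=
  GRing.isSubringClosed.Build F (vring v) (vring_subring v).
HB.instance Definition _ (F : fieldType) (v : valuation F) :=
  GRing.isZmodClosed.Build F (vmax v) (vmax_zmod v).

Section ValuationRing.
Variables (F : fieldType) (v : valuation F).
Implicit Types x y : F.

Lemma vmax_vring x : x \in vmax v -> x \in vring v.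
Proof. by rewrite vringE vmaxE => /orP[->//|/ltW->]; rewrite orbT. Qed.

Lemma vmaxMl x y : x \in vring v -> y \in vmax v -> x * y \in vmax v.
Proof.
rewrite vringE !vmaxE => /orP[/eqP->|vx] /orP[/eqP->|vy];
  rewrite ?mul0r ?mulr0 ?eqxx //.
have [->|x0] := eqVneq x 0; first by rewrite mul0r eqxx.
have [->|y0] := eqVneq y 0; first by rewrite mulr0 eqxx.
by rewrite valM // ltr_wpDl ?orbT.
Qed.

Lemma vring_unitP x : x \in vring v -> (x \notin vmax v) = (x != 0) && (v x == 0).
Proof.
rewrite vringE vmaxE; have [->|x0] := eqVneq x 0; first by [].
by rewrite /= => vx; rewrite -leNgt eq_le vx andbT.
Qed.

Lemma one_notin_vmax : 1 \notin vmax v.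
Proof. by rewrite vring_unitP ?rpred1 // oner_neq0 val1. Qed.

(** After division by [x] this says that [1 + y / x] is a unit. *)
Lemma val_dominant x y : x != 0 -> y / x \in vmax v ->
  x + y != 0 /\ v (x + y) = v x.
Proof.
move=> x0 yx.
have -> : x + y = x * (1 + y / x) by rewrite mulrDr mulr1 mulrC divfK.
have : 1 + y / x \notin vmax v.
  by apply: contra one_notin_vmax => /rpredB/(_ yx); rewrite addrK.
rewrite vring_unitP ?rpredD ?rpred1 ?vmax_vring // => /andP[u0 /eqP vu].
by rewrite mulf_neq0 ?valM // vu addr0.
Qed.

(** At a pole of [x] the leading term of a monic polynomial dominates. *)
Lemma val_monic_horner_pole (g : {poly F}) x :
    g \is monic -> g \is a polyOver (vring v) -> x != 0 -> v x < 0 ->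
  g.[x] != 0 /\ v g.[x] = v x *+ (size g).-1.
Proof.
move=> mong Og x0 vx.
have Vx : x^-1 \in vmax v by rewrite vmaxE valV // oppr_gt0 vx orbT.
have xm m : v (x ^+ m) = v x *+ m by apply: valX.
have sg : size g = (size g).-1.+1 by rewrite prednK // size_poly_gt0 monic_neq0.
set N := (size g).-1 in sg *.
have -> : g.[x] = x ^+ N + \sum_(i < N) g`_i * x ^+ i.
  by rewrite horner_coef sg big_ord_recr /= -/N -lead_coefE (monicP mong) mul1r addrC.
have [||-> ->//] := @val_dominant (x ^+ N) (\sum_(i < N) g`_i * x ^+ i).
  by rewrite expf_neq0.
rewrite mulr_suml rpred_sum // => i _; rewrite -mulrA vmaxMl ?(polyOverP Og) //.
have -> : x ^+ N = x ^+ i * x ^+ (N - i) by rewrite -exprD subnKC // ltnW.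
rewrite invfM mulrA.
rewrite divff ?expf_neq0 // mul1r -exprVn.
have : (0 < N - i)%N by rewrite subn_gt0.
case: (N - i)%N => // m _; rewrite exprS mulrC vmaxMl // rpredX //.
exact: vmax_vring.
Qed.

(** A pole of [x] would be a pole of [g.[x]], by dominance of the leading term. *)
Lemma vring_integrally_closed (g : {poly F}) x :
    g \is monic -> g \is a polyOver (vring v) -> (g.[x] \in vring v) ->
  (1 < size g)%N -> x \in vring v.
Proof.
move=> mong Og gx sg; apply/negPn/negP; rewrite vringE negb_or -ltNge => /andP[x0 vx].
have [gx0 vgx] := val_monic_horner_pole mong Og x0 vx.
move: gx; rewrite vringE (negPf gx0) /= vgx leNgt => /negP; apply.
by rewrite pmulrn_llt0 // -ltnS prednK // ltnW.
Qed.

End ValuationRing.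

Lemma map_in_alg_vring (F : fieldType) (L : fieldExtType F) (v : valuation F)
    (w : valuation L) e x :
  lies_above w v e -> x \in vring v -> x%:A \in vring w.
Proof.
move=> we; rewrite vringE; have [->|x0] := eqVneq x 0.
  by rewrite scale0r rpred0.
by rewrite /= vringE we // => vx; rewrite mulrn_wge0 ?orbT.
Qed.

(** * A criterion for unramified extensions *)

Lemma ex_minimal_nat (P : nat -> Prop) :
  (exists m, P m) -> exists2 m, P m & forall k, P k -> (m <= k)%N.
Proof.
move=> [m Pm]; have exP : exists m, boolp.asbool (P m).
  by exists m; apply/boolp.asboolP.
case: (ex_minnP exP) => k /boolp.asboolP Pk kmin.
by exists k => // l Pl; apply: kmin; apply/boolp.asboolP.
Qed.

Lemma horner_algZ (F : fieldType) (L : fieldExtType F) (z : L) c q :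
  horner_alg z (c *: q) = c *: horner_alg z q.
Proof. by rewrite linearZ /= mulr_algl. Qed.

Lemma leq_neq_predn m j : (m.-1 <= j)%N -> j != m.-1 -> (m <= j)%N.
Proof. by case: m => //= m; rewrite leq_eqVlt eq_sym => /orP[->|]. Qed.

Section Unramified.
Variables (F : fieldType) (L : fieldExtType F).
Variables (v : valuation F) (w : valuation L) (e : nat) (z : L).
Hypothesis we : lies_above w v e.
Hypothesis e_gt0 : (0 < e)%N.
Hypothesis Oz : z \in vring w.

Local Notation Ov := (vring v).
Local Notation ev := (horner_alg z).

Lemma horner_alg_vring (q : {poly F}) : q \is a polyOver Ov -> ev q \in vring w.
Proof.
move=> Oq; apply: rpred_horner => //; apply/polyOverP=> i; rewrite coef_map.
by apply: (map_in_alg_vring we); apply: (polyOverP Oq).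
Qed.

(** Division by a monic polynomial stays inside the valuation ring, since no
    coefficient has to be inverted. *)
Lemma monic_division (g c : {poly F}) :
    g \is monic -> g \is a polyOver Ov -> c \is a polyOver Ov ->
  exists q r, [/\ q \is a polyOver Ov, r \is a polyOver Ov, c = q * g + r
                & (size r < size g)%N].
Proof.
move=> mong Og; have [m] := ubnP (size c); elim: m c => // m IH c sc Oc.
have [cg|gc] := ltnP (size c) (size g).
  by exists 0, c; rewrite !rpred0 mul0r add0r.
have g0 : (0 < size g)%N by rewrite size_poly_gt0 monic_neq0.
have c0 : c != 0 by rewrite -size_poly_gt0 (leq_trans g0).
pose t : {poly F} := lead_coef c *: 'X^(size c - size g).
have Ot : t \is a polyOver Ov.
  by rewrite polyOverZ ?polyOverXn // lead_coefE (polyOverP Oc).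
have [||q [r [Oq Or Ec sr]]] := IH (c - t * g); last first.
- exists (q + t), r; split; rewrite ?rpredD //.
  by rewrite mulrDl addrAC -Ec subrK.
- by rewrite rpredB ?rpredM.
rewrite -ltnS; apply: leq_trans sc; rewrite !ltnS -[leqRHS](prednK (leq_trans g0 gc)) ltnS.
apply/leq_sizeP => j cj; rewrite coefB /t -scalerAl coefZ coefXnM.
have gj : (size c - size g <= j)%N by lia.
rewrite ltnNge gj /=; have [->|cj'] := eqVneq j (size c).-1.
  have -> : ((size c).-1 - (size c - size g) = (size g).-1)%N by lia.
  by rewrite -!lead_coefE (monicP mong) mulr1 subrr.
have cj2 := leq_neq_predn cj cj'.
rewrite [c`_j]nth_default // [g`_ _]nth_default ?mulr0 ?subr0 //.
by apply: leq_trans (leq_sub2r _ cj2); rewrite subKn.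
Qed.

Variables (pi : F).
Hypotheses (pi0 : pi != 0) (vpi : v pi = 1).

Lemma vmax_uniformizer c : c \in vmax v -> c / pi \in Ov.
Proof.
rewrite vmaxE vringE; have [->|c0] := eqVneq c 0; first by rewrite mul0r eqxx.
by rewrite /= valM ?invr_neq0 // valV // vpi => ?; apply/orP; right; lia.
Qed.

Lemma in_alg_vmax c : c \in vmax v -> c%:A \in vmax w.
Proof.
rewrite !vmaxE; have [->|c0] := eqVneq c 0; first by rewrite scale0r eqxx.
by rewrite /= we // => vc; rewrite pmulrn_lgt0 ?vc ?orbT.
Qed.

Lemma scale_uniformizer_vmax x : x \in vring w -> pi *: x \in vmax w.
Proof.
by move=> Ox; rewrite -mulr_algl mulrC vmaxMl // in_alg_vmax // vmaxE vpi orbT.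
Qed.

Section MinimalRelation.
Variable g : {poly F}.

Hypothesis gmin : forall h : {poly F}, h \is monic -> h \is a polyOver Ov ->
  ev h \in vmax w -> (size g <= size h)%N.

(** A relation mod the maximal ideal of lower degree than the minimal one can
    have no unit coefficient: made monic it would contradict minimality. *)
Lemma small_relation (r : {poly F}) :
    r \is a polyOver Ov -> (size r < size g)%N -> ev r \in vmax w ->
  exists2 r', r' \is a polyOver Ov & r = pi *: r'.
Proof.
have [m] := ubnP (size r); elim: m r => // m IH r sr Or rg rz.
have [->|r0] := eqVneq r 0; first by exists 0; rewrite ?rpred0 ?scaler0.
have Oc : lead_coef r \in Ov by rewrite lead_coefE (polyOverP Or).
have c0 : lead_coef r != 0 by rewrite lead_coef_eq0.
set c := lead_coef r in Oc c0.
have mc : c \in vmax v.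
  apply/negPn/negP => /[dup] nmc; rewrite vring_unitP // => /andP[_ /eqP vc].
  have OV : c^-1 \in Ov by rewrite vringE valV // vc oppr0 lexx orbT.
  have /gmin : c^-1 *: r \is monic by rewrite monicE lead_coefZ mulVf.
  rewrite size_scale ?invr_neq0 // leqNgt rg => H; suff: false by [].
  apply: H; first by rewrite polyOverZ.
  rewrite horner_algZ -mulr_algl vmaxMl //.
  exact: (map_in_alg_vring we).
pose t : {poly F} := c *: 'X^((size r).-1).
have Ot : t \is a polyOver Ov by rewrite polyOverZ ?polyOverXn.
have st : (size (r - t)%R < size r)%N.
  have sr0 : (0 < size r)%N by rewrite size_poly_gt0.
  rewrite -[X in (_ < X)%N](prednK sr0) ltnS; apply/leq_sizeP => j rj.
  rewrite coefB coefZ coefXn; have [->|nj] := eqVneq j (size r).-1.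
    by rewrite mulr1 -lead_coefE subrr.
  by rewrite mulr0 subr0 nth_default // leq_neq_predn.
have tz : ev t \in vmax w.
  rewrite horner_algZ -mulr_algl mulrC vmaxMl ?in_alg_vmax //.
  by rewrite horner_alg_vring ?polyOverXn.
have [||||r' Or' Er] := IH (r - t).
- exact: leq_trans st sr.
- by rewrite rpredB.
- exact: ltn_trans st _.
- by rewrite rmorphB rpredB.
exists (r' + (c / pi) *: 'X^((size r).-1)).
  by rewrite rpredD ?polyOverZ ?polyOverXn ?vmax_uniformizer.
by rewrite scalerDr -Er scalerA mulrC divfK // subrK.
Qed.

End MinimalRelation.

Variable G : {poly F}.
Hypotheses (monG : G \is monic) (OG : G \is a polyOver Ov).
Hypotheses (Gz : ev G = 0) (dGz : ev G^`() \notin vmax w).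

(** The prime element [pi] generates the maximal ideal locally: by separability
    the cofactor [h] of the minimal relation in [G] is a unit at [z]. *)
Lemma local_uniformizer : exists2 h : {poly F},
    h \is a polyOver Ov /\ ev h \notin vmax w &
    forall c, c \is a polyOver Ov -> ev c \in vmax w ->
    exists2 d, d \is a polyOver Ov & ev h * ev c = pi *: ev d.
Proof.
pose rel m := exists g : {poly F},
  [/\ g \is monic, g \is a polyOver Ov, ev g \in vmax w & size g = m].
have [|m [g [mong Og gz sg]] gmin'] := @ex_minimal_nat rel.
  by exists (size G), G; rewrite Gz rpred0.
have gmin (h : {poly F}) : h \is monic -> h \is a polyOver Ov ->
    ev h \in vmax w -> (size g <= size h)%N.
  by move=> *; rewrite sg; apply: gmin'; exists h.
have small := small_relation gmin.
have [h [r [Oh Or EG sr]]] := monic_division mong Og OG.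
have Ogh : ev h * ev g \in vmax w by rewrite vmaxMl // horner_alg_vring.
have [//|//||r' Or' Er] := small r.
  have -> : r = G - h * g by rewrite EG addrC addKr.
  by rewrite rmorphB rmorphM /= Gz sub0r rpredN.
have Egh : ev h * ev g = - (pi *: ev r').
  apply/eqP; rewrite -subr_eq0 opprK -horner_algZ -Er.
  by rewrite -rmorphM -rmorphD /= -EG Gz.
exists h.
  (* At [z], [G' = h' g + h g' + pi r''], so [h] cannot vanish modulo the
     maximal ideal when [G'] does not. *)
  split=> //; apply: contra dGz => hz.
  rewrite EG Er derivD derivM derivZ !rmorphD !rmorphM /= horner_algZ.
  have ? : ev r'^`() \in vring w by rewrite horner_alg_vring ?polyOver_deriv.
  have ? : ev h^`() \in vring w by rewrite horner_alg_vring ?polyOver_deriv.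
  have ? : ev g^`() \in vring w by rewrite horner_alg_vring ?polyOver_deriv.
  rewrite rpredD ?scale_uniformizer_vmax // rpredD ?[ev h * _]mulrC //.
    exact: vmaxMl.
  exact: vmaxMl.
move=> c Oc cz; have [q [s [Oq Os Ec ss]]] := monic_division mong Og Oc.
have [//|//||s' Os' Es] := small s.
  have -> : s = c - q * g by rewrite Ec addrC addKr.
  by rewrite rmorphB rmorphM /= rpredB // vmaxMl // horner_alg_vring.
exists (h * s' - q * r'); first by rewrite rpredB ?rpredM.
rewrite Ec rmorphD rmorphB !rmorphM /= Es horner_algZ mulrDr mulrCA Egh.
by rewrite scalerBr !scalerAr mulrN addrC.
Qed.

(** Dividing by [pi] lowers the value by [e] and stays in the ring generated by
    [z], up to a unit: descent on the value. *)
Lemma val_horner_alg_dvd c : c \is a polyOver Ov -> ev c != 0 ->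
  (e %| w (ev c))%Z.
Proof.
have [h [Oh hz] loc] := local_uniformizer.
move: hz; rewrite vring_unitP ?horner_alg_vring // => /andP[h0 /eqP wh].
have [m] := ubnP `|w (ev c)|%N; elim: m c => // m IH c wm Oc c0.
have := horner_alg_vring Oc; rewrite vringE (negPf c0) /= le_eqVlt.
case/orP=> [/eqP <-|wc]; first exact: dvdz0.
have [//||d Od Ed] := loc c; first by rewrite vmaxE wc orbT.
have d0 : ev d != 0.
  by apply: contraTneq (mulf_neq0 h0 c0) => d0; rewrite Ed d0 scaler0 eqxx.
have piA0 : pi%:A != 0 :> L by rewrite scaler_eq0 oner_eq0 orbF.
have Ewc : w (ev c) = e%:Z + w (ev d).
  have := congr1 w Ed; rewrite valM // wh add0r => ->.
  by rewrite -mulr_algl valM // we // vpi natz.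
rewrite Ewc rpredD // IH //.
have := horner_alg_vring Od; rewrite vringE (negPf d0) /=.
by move: wm e_gt0; rewrite Ewc; move: (w (ev d)) => k; clear; lia.
Qed.

End Unramified.

Lemma clear_uniformizer (F : fieldType) (v : valuation F) pi (q : {poly F}) :
    pi != 0 -> v pi = 1 ->
  exists m, pi ^+ m *: q \is a polyOver (vring v).
Proof.
move=> pi0 vpi; elim/poly_ind: q => [|q c [m Oq]].
  by exists 0%N; rewrite scaler0 rpred0.
have Opi : pi \in vring v by rewrite vringE vpi orbT.
have [k Oc] : exists k, pi ^+ k * c \in vring v.
  have [->|c0] := eqVneq c 0; first by exists 0%N; rewrite mulr0 rpred0.
  exists `|v c|%N; rewrite vringE valM ?expf_neq0 // valX // vpi.
  by apply/orP; right; lia.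
exists (k + m)%N; rewrite scalerDr scalerAl rpredD ?rpredM ?polyOverX //.
  by rewrite exprD -scalerA polyOverZ ?rpredX.
by rewrite -mul_polyC -polyCM polyOverC addnC exprD -mulrA rpredM ?rpredX.
Qed.

(** Up to a power of [pi] every element of [L] is an integral polynomial in [z],
    so all values are multiples of the index; but the value 1 is taken. *)
Lemma unramified_of_separable (F : fieldType) (L : fieldExtType F)
    (v : valuation F) (z : L) (G : {poly F}) :
    <<1; z>>%VS = fullv ->
    G \is monic -> G \is a polyOver (vring v) -> horner_alg z G = 0 ->
    (forall (w : valuation L) e, lies_above w v e -> (0 < e)%N ->
       horner_alg z G^`() \notin vmax w) ->
  ~ ramified L v.
Proof.
move=> genz monG OG Gz dG [w' [e [dw we e1]]].
pose w := Valuation dw; have e0 : (0 < e)%N by apply: ltnW.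
have {}we : lies_above w v e by [].
have Oz : z \in vring w.
  apply: (@vring_integrally_closed _ w (map_poly (in_alg L) G)).
  - exact: monic_map.
  - apply/polyOverP => i; rewrite coef_map; apply: (map_in_alg_vring we).
    exact: (polyOverP OG).
  - by rewrite [X in X \in _](Gz : _ = 0) rpred0.
  rewrite size_map_poly ltnNge; apply/negP => sG.
  have G1 := size1_polyC sG; move: Gz monG; rewrite G1 monicE lead_coefC.
  move=> + /eqP c1; rewrite c1 rmorph1 => /eqP; by rewrite oner_eq0.
have [pi pi0 vpi] := uniformizer_exists v.
have dvd_e x : x != 0 -> (e %| w x)%Z.
  move=> x0; have /Fadjoin_polyP[q Kq Ex] : x \in <<1; z>>%VS by rewrite genz memvf.
  have /polyOver1P[q' Eq] := Kq.
  have {Ex} Ex : x = horner_alg z q' by rewrite Ex Eq.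
  have [m Oq] := clear_uniformizer q' pi0 vpi.
  have pim0 : (pi ^+ m)%:A != 0 :> L by rewrite scaler_eq0 oner_eq0 orbF expf_neq0.
  have Emx : horner_alg z (pi ^+ m *: q') = (pi ^+ m)%:A * x.
    by rewrite horner_algZ -Ex mulr_algl.
  have := val_horner_alg_dvd we e0 Oz pi0 vpi monG OG Gz (dG _ _ we e0) Oq.
  rewrite Emx mulf_neq0 // => /(_ isT); rewrite valM // we ?expf_neq0 //.
  by rewrite rpredDl // -mulr_natr natz dvdz_mull.
have [x x0 wx] := uniformizer_exists w.
by have := dvd_e x x0; rewrite wx dvdz1; lia.
Qed.

(** * Extension of discrete valuations *)

Section MaximalSubring.
Variables (F : fieldType) (L : fieldExtType F) (v : valuation F) (pi : F).
Hypotheses (pi0 : pi != 0) (vpi : v pi = 1).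

Local Notation piA := (pi%:A : L).

(** In a subring containing the valuation ring, [pi] is a nonunit exactly when
    its inverse is missing; this says that the subring lies over [v]. *)
Record dominating (B : L -> Prop) : Prop := Dominating {
  dom_vring : forall c, c \in vring v -> B c%:A;
  domB : forall x y, B x -> B y -> B (x - y);
  domM : forall x y, B x -> B y -> B (x * y);
  dom_pi : ~ B (piA^-1) }.

Lemma piA_neq0 : piA != 0.
Proof. by rewrite scaler_eq0 oner_eq0 orbF. Qed.

Lemma vring_dominating :
  dominating (fun x => exists2 c, c \in vring v & x = c%:A).
Proof.
split=> [c Oc|x y [c Oc ->] [d Od ->]|x y [c Oc ->] [d Od ->]|[c Oc Ec]].
- by exists c.
- by exists (c - d); rewrite ?rpredB // scalerBl.
- by exists (c * d); rewrite ?rpredM // -scalerAl mul1r scalerA.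
have : v pi^-1 = -1 by rewrite valV // vpi.
have -> : pi^-1 = c by apply: (fmorph_inj (in_alg L)); rewrite fmorphV; exact: Ec.
by move=> vc; move: Oc Ec; rewrite vringE vc orbF => /eqP ->;
  rewrite scale0r => /eqP; rewrite invr_eq0 (negPf piA_neq0).
Qed.

(** Zorn's lemma.  The union of the empty chain being empty, the empty set has to
    be admitted along with the dominating subrings. *)
Lemma maximal_dominating_exists : exists2 B, dominating B &
  forall C : L -> Prop, dominating C -> (forall x, B x -> C x) ->
    forall x, C x -> B x.
Proof.
pose P (B : L -> Prop) := (forall x, ~ B x) \/ dominating B.
have [|B [PB Bmax]] := @classical_sets.Zorn_bigcup L P.
  move=> FF FP tot.
  have [|nex] := boolp.pselect (exists2 X, FF X & exists x, X x); last first.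
    by left=> x [X FX Xx]; apply: nex; exists X => //; exists x.
  move=> [X0 FX0 [x0 Xx0]]; right.
  have good X x : FF X -> X x -> dominating X.
    by move=> FX Xx; case: (FP _ FX) => // /(_ x).
  have both x y : (classical_sets.bigcup FF id) x ->
      (classical_sets.bigcup FF id) y -> exists X, [/\ FF X, X x & X y].
    move=> [X FX Xx] [Y FY Yy]; have [XY|YX] := tot X Y FX FY.
      by exists Y; split=> //; apply: XY.
    by exists X; split=> //; apply: YX.
  split=> [c Oc|x y /both Bx /Bx[X [FX Xx Xy]]|x y /both Bx /Bx[X [FX Xx Xy]]|].
  - by exists X0 => //; apply: (dom_vring (good _ _ FX0 Xx0)).
  - by exists X => //; apply: (domB (good _ _ FX Xx)).
  - by exists X => //; apply: (domM (good _ _ FX Xx)).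
  by move=> [X FX Xpi]; apply: (dom_pi (good _ _ FX Xpi)).
have gB : dominating B.
  case: PB => // B0; case: (Bmax (fun x => exists2 c, c \in vring v & x = c%:A)).
    split=> [x /B0 //|sub]; apply: (B0 (1%:A)); apply: sub.
    by exists 1; rewrite ?rpred1.
  by right; apply: vring_dominating.
exists B => // C gC BC; apply: boolp.contrapT => nCB.
by apply: (Bmax C); [split | right].
Qed.

Variable B : L -> Prop.
Hypothesis gB : dominating B.
Hypothesis maxB : forall C : L -> Prop, dominating C ->
  (forall x, B x -> C x) -> forall x, C x -> B x.

Let BB := domB gB.
Let BM := domM gB.
Let Bv := dom_vring gB.

Lemma dom1 : B 1.
Proof. by rewrite -[1]scale1r; apply: Bv; apply: rpred1. Qed.

Lemma dom0 : B 0.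
Proof. by rewrite -(subrr 1); apply: BB; apply: dom1. Qed.

Lemma domN x : B x -> B (- x).
Proof. by move=> Bx; rewrite -sub0r; apply: BB => //; apply: dom0. Qed.

Lemma domD x y : B x -> B y -> B (x + y).
Proof. by move=> Bx By; rewrite -[y]opprK; apply: BB => //; apply: domN. Qed.

Lemma domX x m : B x -> B (x ^+ m).
Proof.
by move=> Bx; elim: m => [|m IH]; rewrite ?expr0 ?exprS; [apply: dom1 | apply: BM].
Qed.

Lemma dom_piA : B piA.
Proof. by apply: Bv; rewrite vringE vpi orbT. Qed.

Definition domp (q : {poly L}) := forall i, B q`_i.

Lemma dompB p q : domp p -> domp q -> domp (p - q).
Proof. by move=> Bp Bq i; rewrite coefB; apply: BB. Qed.

Lemma dompD p q : domp p -> domp q -> domp (p + q).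
Proof. by move=> Bp Bq i; rewrite coefD; apply: domD. Qed.

Lemma dompM p q : domp p -> domp q -> domp (p * q).
Proof.
move=> Bp Bq i; rewrite coefM; apply: big_ind => [|x y|j _].
- exact: dom0.
- exact: domD.
- exact: BM.
Qed.

Lemma dompC c : B c -> domp c%:P.
Proof. by move=> Bc i; rewrite coefC; case: ifP => // _; apply: dom0. Qed.

Lemma dompXn m : domp 'X^m.
Proof. by move=> i; rewrite coefXn; case: eqP => _; [apply: dom1 | apply: dom0]. Qed.

(** Inverting the elements of [1 + pi B] keeps [pi] a nonunit. *)
Lemma dom_inv_1p b : B b -> 1 + piA * b != 0 /\ B (1 + piA * b)^-1.
Proof.
move=> Bb; set s := 1 + _.
have Bs : B s by apply: domD; [apply: dom1 | apply: BM => //; apply: dom_piA].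
have s0 : s != 0.
  apply/eqP => s0; apply: (dom_pi gB); have -> : piA^-1 = - b; last exact: domN.
  apply: (mulfI piA_neq0); rewrite divff ?piA_neq0 // mulrN.
  by apply/eqP; rewrite -addr_eq0 -/s s0.
split=> //.
apply: (maxB (C := fun t => exists k, B (s ^+ k * t))); first split.
- by move=> c Oc; exists 0%N; rewrite mul1r; apply: Bv.
- move=> x y [k Bx] [l By]; exists (k + l)%N; rewrite mulrBr; apply: BB.
    by rewrite addnC exprD -mulrA; apply: BM => //; apply: domX.
  by rewrite exprD -mulrA; apply: BM => //; apply: domX.
- move=> x y [k Bx] [l By]; exists (k + l)%N.
  by rewrite exprD mulrACA; apply: BM.
- have Es k : exists2 b', B b' & s ^+ k = 1 + piA * b'.
    elim: k => [|k [b' Bb' IH]].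
      by exists 0; [apply: dom0 | rewrite mulr0 addr0].
    exists (b' + b + b * b' * piA).
      apply: domD; first exact: domD.
      by apply: BM dom_piA; apply: BM.
    by rewrite exprS IH /s; ring.
  move=> [k]; have [b' Bb' ->] := Es k.
  rewrite mulrDl mul1r [piA * b']mulrC mulfK ?piA_neq0 // => H.
  by apply: (dom_pi gB); rewrite -[piA^-1](addrK b'); apply: BB.
- by move=> x Bx; exists 0%N; rewrite mul1r.
by exists 1%N; rewrite expr1 divff //; apply: dom1.
Qed.

(** By maximality [B[x]] does not dominate, so it contains the inverse of
    [pi]. *)
Lemma notin_dom x : ~ B x -> exists2 q, domp q & piA * q.[x] = 1.
Proof.
move=> nBx; apply: boolp.contrapT => nq; apply: nBx.
apply: (maxB (C := fun t => exists2 q, domp q & t = q.[x])); first split.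
- move=> c Oc; exists (c%:A)%:P; last by rewrite hornerC.
  by apply: dompC; apply: Bv.
- move=> _ _ [p Bp ->] [q Bq ->]; exists (p - q); first exact: dompB.
  by rewrite hornerD hornerN.
- move=> _ _ [p Bp ->] [q Bq ->]; exists (p * q); first exact: dompM.
  by rewrite hornerM.
- move=> [q Bq Eq]; apply: nq; exists q => //.
  by rewrite -Eq divff ?piA_neq0.
- by move=> t Bt; exists t%:P; [apply: dompC | rewrite hornerC].
by exists 'X; [apply: (dompXn 1) | rewrite hornerX].
Qed.

(** Two relations of this kind, for [x] and for its inverse, would reduce each
    other's degree for ever. *)
Lemma no_double_relation (q q' : {poly L}) x : x != 0 -> domp q -> domp q' ->
  piA * q.[x] = 1 -> piA * q'.[x^-1] = 1 -> False.
Proof.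
have [N] := ubnP (size q + size q').
elim: N q q' x => // N IH q q' x sN x0 Bq Bq' qx qx'.
wlog le_q : q q' x sN x0 Bq Bq' qx qx' / (size q' <= size q)%N.
  move=> H; have [le_q|/ltnW le_q] := leqP (size q') (size q).
    exact: (H q q' x).
  by apply: (H q' q x^-1); rewrite ?invrK ?invr_eq0 // addnC.
have q0 : (0 < size q)%N.
  rewrite size_poly_gt0; apply/eqP => q00; move/eqP: qx.
  by rewrite q00 horner0 mulr0 eq_sym oner_eq0.
set m := (size q).-1; have sq : size q = m.+1 by rewrite prednK.
have [] := @dom_inv_1p (- q'`_0); first exact: domN.
rewrite mulrN; set s := 1 - _ => s0 Bs.
(* [rv] is the reversal of [q'] without its constant term: the relation for
   the inverse of [x], multiplied by [x ^+ m], expresses [x ^+ m] through lower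
   powers. *)
pose rv := \poly_(i < m) q'`_(m - i).
have Brv : domp rv.
  by move=> i; rewrite coef_poly; case: ifP => // _; apply: dom0.
have Exm : x ^+ m = piA * s^-1 * rv.[x].
  have : x ^+ m * (piA * q'.[x^-1]) = x ^+ m by rewrite qx' mulr1.
  rewrite (horner_coef_wide _ (n := m.+1)) -?sq //.
  rewrite sq mulrCA mulr_sumr (reindex_inj rev_ord_inj) /=.
  have -> : \sum_(j < m.+1) x ^+ m * (q'`_(m.+1 - j.+1) * x^-1 ^+ (m.+1 - j.+1))
      = rv.[x] + q'`_0 * x ^+ m.
    rewrite big_ord_recr /= horner_poly !subSS subnn expr0 mulr1 mulrC.
    congr (_ + _); apply: eq_bigr => i _; rewrite subSS mulrCA; congr (_ * _).
    have im : (i <= m)%N by apply: ltnW.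
    rewrite -[X in x ^+ X](subnK im) exprD exprVn mulrAC divff ?mul1r //.
    by rewrite expf_neq0.
  move=> Ex; apply: (mulfI s0); rewrite [RHS]mulrA mulrCA divff // mulr1.
  by rewrite /s mulrBl mul1r -{1}Ex; ring.
pose q1 := q - (q`_m)%:P * 'X^m + (piA * s^-1 * q`_m)%:P * rv.
apply: (IH q1 q' x) => //.
- rewrite -ltnS; apply: leq_trans sN; rewrite !ltnS ltn_add2r sq ltnS.
  apply/leq_sizeP => j mj; rewrite /q1 coefD coefB !coefCM coefXn coef_poly.
  rewrite ltnNge mj mulr0 addr0; have [->|nj] := eqVneq j m.
    by rewrite mulr1 subrr.
  by rewrite mulr0 subr0 nth_default // sq ltn_neqAle eq_sym nj.
- have Bqm := Bq m; apply: dompD.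
    by apply: dompB => //; apply: dompM; [apply: dompC | apply: dompXn].
  apply: dompM => //; apply: dompC; apply: BM => //; apply: BM => //.
  exact: dom_piA.
rewrite /q1 !hornerD hornerN !hornerM !hornerC hornerXn Exm -[RHS]qx.
by ring.
Qed.

Lemma dom_valuation_ring x : x != 0 -> B x \/ B x^-1.
Proof.
move=> x0; have [|/notin_dom[q Bq qx]] := boolp.pselect (B x); first by left.
have [|/notin_dom[q' Bq' qx']] := boolp.pselect (B x^-1); first by right.
by case: (no_double_relation x0 Bq Bq' qx qx').
Qed.

(** The nonunits of a valuation ring form an ideal, so [1 + x] is a unit. *)
Lemma dom_1p_nonunit x : x != 0 -> B x -> ~ B x^-1 ->
  1 + x != 0 /\ B (1 + x)^-1.
Proof.
move=> x0 Bx nBx.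
have x1 : 1 + x != 0.
  apply/eqP => x1; apply: nBx; have -> : x = -1.
    by apply/eqP; rewrite -addr_eq0 addrC x1.
  by rewrite invrN1; apply/domN/dom1.
split=> //.
have := @dom_valuation_ring (x / (1 + x)); rewrite mulf_neq0 ?invr_neq0 //.
case=> // [Bu|].
  have -> : (1 + x)^-1 = 1 - x / (1 + x) by field.
  by apply: BB => //; apply: dom1.
rewrite invfM invrK mulrC mulrDl mul1r divff // => Bu; case: nBx.
by rewrite -[x^-1](addrK 1); apply: BB => //; apply: dom1.
Qed.

(** Equality of [x] and [y] in the value group of [B]. *)
Definition assoc x y := [/\ x != 0, y != 0, B (x / y) & B (y / x)].

Lemma assoc_refl x : x != 0 -> assoc x x.
Proof. by move=> x0; split; rewrite // divff //; apply: dom1. Qed.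

Lemma assoc_sym x y : assoc x y -> assoc y x.
Proof. by case. Qed.

Lemma assoc_trans x y z : assoc x y -> assoc y z -> assoc x z.
Proof.
move=> [x0 y0 Bxy Byx] [_ z0 Byz Bzy]; split=> //.
  by have -> : x / z = x / y * (y / z) by [field; rewrite y0 z0]; apply: BM.
by have -> : z / x = z / y * (y / x) by [field; rewrite y0 x0]; apply: BM.
Qed.

Lemma assocM x y z t : assoc x y -> assoc z t -> assoc (x * z) (y * t).
Proof.
move=> [x0 y0 Bxy Byx] [z0 t0 Bzt Btz]; split; rewrite ?mulf_neq0 //.
  by rewrite invfM mulrACA; apply: BM.
by rewrite invfM mulrACA; apply: BM.
Qed.

Lemma assocV x y : assoc x y -> assoc x^-1 y^-1.
Proof.
by move=> [x0 y0 Bxy Byx]; split; rewrite ?invr_neq0 // invrK mulrC.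
Qed.

Lemma assocX x y m : assoc x y -> assoc (x ^+ m) (y ^+ m).
Proof.
move=> xy; elim: m => [|m IH]; first by apply: assoc_refl; apply: oner_neq0.
by rewrite !exprS; apply: assocM.
Qed.

Lemma assoc_dominant x y : x != 0 -> y != 0 -> ~ assoc x y ->
  assoc (x + y) x \/ assoc (x + y) y.
Proof.
wlog Byx : x y / B (y / x) => [H|] x0 y0 nxy.
  have [|Byx|Bxy] := @dom_valuation_ring (y / x).
  - by rewrite mulf_neq0 ?invr_neq0.
  - exact: H.
  rewrite addrC; apply/or_comm; apply: H => //; last by move/assoc_sym.
  by move: Bxy; rewrite invfM invrK mulrC.
left; have yx0 : y / x != 0 by rewrite mulf_neq0 ?invr_neq0.
have [//|//||u0 Bu] := @dom_1p_nonunit (y / x).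
  by rewrite invfM invrK mulrC => Bxy; apply: nxy.
have -> : x + y = x * (1 + y / x) by rewrite mulrDr mulr1 mulrC divfK.
split; rewrite ?mulf_neq0 //.
  by rewrite mulrAC divff // mul1r; apply: domD => //; apply: dom1.
by rewrite invfM mulrA divff // mul1r.
Qed.

(** Terms with pairwise different values cannot cancel. *)
Lemma assoc_sum (t : nat -> L) n :
    (forall i j, (i < j < n)%N -> ~ assoc (t i) (t j)) ->
  (forall i, (i < n)%N -> t i = 0) \/
  exists2 i, (i < n)%N & assoc (\sum_(k < n) t k) (t i).
Proof.
elim: n => [|n IH] nt; first by left.
rewrite big_ord_recr /=; have [|t0|[i ltin Hi]] := IH.
- by move=> i j /andP[ij jn]; apply: nt; rewrite ij ltnW.
- have S0 : \sum_(k < n) t k = 0 by rewrite big1 // => k _; apply: t0.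
  rewrite S0 add0r; have [tn0|tn0] := eqVneq (t n) 0.
    by left=> i; rewrite ltnS leq_eqVlt => /orP[/eqP->|/t0].
  by right; exists n => //; apply: assoc_refl.
right; have [tn0|tn0] := eqVneq (t n) 0.
  by rewrite tn0 addr0; exists i => //; apply: ltnW.
have [S0 _ _ _] := Hi; case: (@assoc_dominant (\sum_(k < n) t k) (t n)) => //.
- move=> H; apply: (nt i n); first by rewrite ltin ltnSn.
  exact: assoc_trans (assoc_sym Hi) H.
- by move=> H; exists i; [apply: ltnW | apply: assoc_trans H Hi].
by move=> H; exists n.
Qed.

Lemma assoc_base c : c != 0 -> assoc c%:A (piA ^ (v c)).
Proof.
move=> c0; have piz0 : pi ^ (v c) != 0 by rewrite expfz_neq0.
have vpiz : v (pi ^ (v c)) = v c.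
  have vz k : v (pi ^ k) = k.
    case: k => k; first by rewrite -exprnP valX // vpi natz.
    by rewrite NegzE -exprnN valV ?expf_neq0 // valX // vpi natz.
  exact: vz.
have -> : piA ^ (v c) = (pi ^ (v c))%:A by rewrite -[RHS]/(in_alg L _) fmorphXz.
have A0 a : a != 0 -> a%:A != 0 :> L by move=> ?; rewrite scaler_eq0 oner_eq0 orbF.
have Bdiv a b : a != 0 -> b != 0 -> v a = v b -> B (a%:A / b%:A).
  move=> a0 b0 vab; have -> : a%:A / b%:A = (a / b)%:A :> L.
    by rewrite -[RHS]/(in_alg L _) fmorph_div.
  by apply: Bv; rewrite vringE valM ?invr_neq0 // valV // vab subrr lexx orbT.
by split; rewrite ?A0 //; apply: Bdiv.
Qed.

Lemma dom_piXz k : B (piA ^ k) -> 0 <= k.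
Proof.
case: k => // k; rewrite NegzE -exprnN => BV; case: (dom_pi gB).
have -> : piA^-1 = piA ^+ k * piA ^- k.+1.
  by rewrite exprS invfM mulrCA divff ?mulr1 // expf_neq0 // piA_neq0.
by apply: BM => //; apply: domX; apply: dom_piA.
Qed.

Lemma assoc_piXz k l : assoc (piA ^ k) (piA ^ l) -> k = l.
Proof.
have piu := piA_neq0; move=> [_ _]; rewrite !invr_expz -!expfzDr //.
move=> /dom_piXz + /dom_piXz; rewrite !subr_ge0 => lk kl.
by apply/eqP; rewrite eq_le lk kl.
Qed.

(** Some relation over [F] holds among the first powers of [x], and two of its
    terms must be associated; the difference of their exponents divides the
    factorial. *)
Lemma assoc_power x : x != 0 ->
  exists k, assoc (x ^+ (\dim {:L})`!) (piA ^ k).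
Proof.
move=> x0; set N := \dim {:L}; pose X := [tuple x ^+ i | i < N.+1].
have nfree : ~ free X.
  move=> /eqP; rewrite size_tuple => E.
  by have := dimvS (subvf <<X>>%VS); rewrite E ltnn.
have [k [k0 [i0 ki0]]] : exists k : 'I_N.+1 -> F,
    \sum_(i < N.+1) k i *: X`_i = 0 /\ exists i, k i != 0.
  apply: boolp.contrapT => nk; apply: nfree; apply/freeP => k k0 i; apply/eqP.
  by apply/negPn/negP => ki; apply: nk; exists k; split=> //; exists i.
pose t i := k (inord i) *: x ^+ i.
have tE : \sum_(i < N.+1) t i = 0.
  rewrite -[RHS]k0; apply: eq_bigr => i _.
  by rewrite /t inord_val -tnth_nth tnth_mktuple.
have [i [j [/andP[ij jN] Aij]]] :
    exists i j, (i < j < N.+1)%N /\ assoc (t i) (t j).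
  apply: boolp.contrapT => nij; have [|t0|[i _ []]] := @assoc_sum t N.+1.
  - by move=> i j ij Aij; apply: nij; exists i, j.
  - move: (t0 i0 (ltn_ord _)); rewrite /t inord_val => /eqP.
    by rewrite scaler_eq0 (negPf ki0) expf_eq0 (negPf x0) andbF.
  by rewrite tE eqxx.
have [ti0 tj0 _ _] := Aij; move: ti0 tj0; rewrite /t !scaler_eq0 !negb_or.
move=> /andP[ki xi0] /andP[kj xj0].
set a := k (inord i) in ki; set b := k (inord j) in kj.
have A0 c : c != 0 -> c%:A != 0 :> L by move=> ?; rewrite scaler_eq0 oner_eq0 orbF.
have Aab : assoc (a%:A / b%:A) (x ^+ (j - i)).
  have y0 : (x ^+ i * b%:A)^-1 != 0 by rewrite invr_neq0 // mulf_neq0 ?A0.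
  have := assocM Aij (assoc_refl y0); rewrite /t -/a -/b.
  rewrite -(mulr_algl a (x ^+ i)) -(mulr_algl b (x ^+ j)).
  have -> : x ^+ j = x ^+ (j - i) * x ^+ i by rewrite -exprD subnK // ltnW.
  congr (assoc _ _); first by field; rewrite xi0 A0.
  by field; rewrite xi0 A0.
have Aab' := assocM (assoc_base ki) (assocV (assoc_base kj)).
have Ad := assoc_trans (assoc_sym Aab) Aab'.
have /dvdnP[q ->] : (j - i %| N`!)%N.
  by apply: dvdn_fact; rewrite subn_gt0 ij (leq_trans (leq_subr i j) jN).
exists ((v a - v b) * q%:Z); rewrite mulnC exprM -exprz_exp -exprnP.
by apply: assocX; rewrite expfzDr ?piA_neq0 // -invr_expz.
Qed.

End MaximalSubring.

(** A maximal dominating subring is a valuation ring.  If [N] is the degree, the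
    power [N`!] of any [x] is a power of [pi] up to a unit ([assoc_power]), and
    the exponent [s x] embeds the value group in the integers.  Dividing by the
    least positive value of [s] makes it surjective. *)
Lemma valuation_extension (F : fieldType) (L : fieldExtType F)
    (v : valuation F) :
  exists (w : valuation L) e, lies_above w v e /\ (0 < e)%N.
Proof.
have [pi pi0 vpi] := uniformizer_exists v.
have [B gB maxB] := maximal_dominating_exists L pi0 vpi.
pose M := (\dim {:L})`!; pose piA : L := pi%:A.
have piu : piA != 0 := piA_neq0 L pi0.
have M0 : (0 < M)%N by apply: fact_gt0.
have power x : exists k, x != 0 -> assoc B (x ^+ M) (piA ^ k).
  have [->|x0] := eqVneq x 0; first by exists 0; rewrite ?eqxx.
  by have [k Hk] := assoc_power pi0 vpi gB maxB x0; exists k.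
have [s Hs] := boolp.choice power.
have sE x k : x != 0 -> assoc B (x ^+ M) (piA ^ k) -> s x = k.
  move=> x0 Hk; apply: (assoc_piXz pi0 vpi gB).
  exact: (assoc_trans gB (assoc_sym (Hs _ x0)) Hk).
have sM x y : x != 0 -> y != 0 -> s (x * y) = s x + s y.
  move=> x0 y0; apply: sE; rewrite ?mulf_neq0 // exprMn expfzDr //.
  exact: (assocM gB (Hs _ x0) (Hs _ y0)).
have s1 : s 1 = 0.
  by have := sM 1 1 (oner_neq0 _) (oner_neq0 _); rewrite mulr1; lia.
have sV x : x != 0 -> s x^-1 = - s x.
  by move=> x0; have := sM x x^-1 x0 (invr_neq0 x0); rewrite divff // s1; lia.
have s_ge0 x : x != 0 -> B x -> 0 <= s x.
  move=> x0 Bx; apply: (dom_piXz pi0 vpi gB).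
  have [_ xM _ Bs] := Hs _ x0; rewrite -(divfK (_ : x ^+ M != 0) (_ ^ _)).
    by apply: (domM gB) => //; apply: (domX gB).
  by rewrite expf_neq0.
have B_of_s x : x != 0 -> 0 <= s x -> B x.
  move=> x0 sx; have [//|Bx] := dom_valuation_ring pi0 vpi gB maxB x0.
  have s0 : s x = 0.
    by have := s_ge0 _ (invr_neq0 x0) Bx; rewrite sV //; lia.
  have [_ _ BxM _] := Hs _ x0; move: BxM; rewrite s0 expr0z divr1 => BxM.
  have -> : x = x ^+ M * x^-1 ^+ M.-1.
    rewrite -{1}(prednK M0) exprS -mulrA -exprMn divff // expr1n mulr1 //.
  by apply: (domM gB) => //; apply: (domX gB).
have sD x y : x != 0 -> y != 0 -> x + y != 0 -> Num.min (s x) (s y) <= s (x + y).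
  wlog sxy : x y / s x <= s y => [H x0 y0 xy0|x0 y0 xy0].
    have /orP[sxy|sxy] := le_total (s x) (s y); first exact: H.
    by rewrite minC addrC; apply: H => //; rewrite addrC.
  have By : B (y / x).
    by apply: B_of_s; rewrite ?mulf_neq0 ?invr_neq0 // sM ?invr_neq0 // sV // subr_ge0.
  have Exy : x + y = x * (1 + y / x) by rewrite mulrDr mulr1 mulrC divfK.
  have u0 : 1 + y / x != 0 by apply: contraNneq xy0 => u0; rewrite Exy u0 mulr0.
  rewrite Exy sM // (min_idPl sxy) lerDl; apply: s_ge0 => //.
  by apply: (domD gB) => //; apply: (dom1 gB).
have sbase c : c != 0 -> s c%:A = v c *+ M.
  move=> c0; apply: sE; first by rewrite scaler_eq0 oner_eq0 orbF.
  rewrite -mulr_natr natz -exprz_exp -exprnP.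
  exact: (assocX gB _ (assoc_base pi0 vpi gB c0)).
pose img d := (0 < d)%N /\ exists2 x, x != 0 & s x = d%:Z.
have [|d [d0 [x0 x00 sx0]] dmin] := @ex_minimal_nat img.
  by exists M; split=> //; exists piA => //; rewrite sbase // vpi natz.
have sX x k : x != 0 -> s (x ^ k) = k * s x.
  move=> xn0; have sXn m : s (x ^+ m) = m%:Z * s x.
    elim: m => [|m IH]; first by rewrite expr0 s1 mul0r.
    by rewrite exprS sM ?expf_neq0 // IH; lia.
  case: k => k; first by rewrite -exprnP sXn.
  by rewrite NegzE -exprnN sV ?expf_neq0 // sXn mulNr.
have dvd_s x : x != 0 -> (d %| s x)%Z.
  move=> xn0; apply/dvdz_mod0P; have dz : (d%:Z) != 0 by rewrite eqz_nat -lt0n.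
  have := modz_ge0 (s x) dz; have := @ltz_pmod (s x) d d0.
  have y0 : x * x0 ^ (- (s x %/ d)%Z) != 0 by rewrite mulf_neq0 ?expfz_neq0.
  have sy : s (x * x0 ^ (- (s x %/ d)%Z)) = (s x %% d)%Z.
    by rewrite sM ?expfz_neq0 // sX // sx0 mulNr {1}(divz_eq (s x) d) addrC addKr.
  case Er : (s x %% d)%Z sy => [[//|r]|r] sy //.
  have /dmin : img r.+1 by split=> //; exists (x * x0 ^ (- (s x %/ d)%Z)).
  by rewrite ltz_nat ltnNge => ->.
pose w x := (s x %/ d)%Z.
have wE x : x != 0 -> s x = w x * d%:Z by move=> xn0; rewrite divzK ?dvd_s.
have dz0 : (0 : int) < d%:Z by rewrite ltz_nat.
have dw : discrete_valuation w.
  split=> [x y xn0 yn0|x y xn0 yn0 xyn0|].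
  - apply: (mulIf (lt0r_neq0 dz0)); rewrite mulrDl -(wE x) // -(wE y) //.
    by rewrite -wE ?mulf_neq0 // sM.
  - rewrite -(ler_pM2r dz0) -wE //; apply: le_trans (sD _ _ xn0 yn0 xyn0).
    by rewrite (minr_pMl _ _ (ltW dz0)) -(wE x) // -(wE y).
  by exists x0 => //; rewrite /w sx0 divzz; case: (d) d0.
have wpi : w piA * d%:Z = M by rewrite -wE // sbase // vpi natz.
have wpi0 : 0 < w piA by rewrite -(pmulr_lgt0 _ dz0) wpi ltz_nat.
exists (Valuation dw), `|w piA|%N; split=> [c c0 /=|]; last by rewrite absz_gt0 gt_eqF.
apply: (mulIf (lt0r_neq0 dz0)); rewrite -wE ?scaler_eq0 ?oner_eq0 ?orbF //.
rewrite sbase // -[LHS]mulr_natr -[_ *+ `|_|%N]mulr_natr !natz -mulrA.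
by rewrite gez0_abs ?wpi // ltW.
Qed.

(** * Valuations of the rational function field *)

Section IrreducibleMultiplicity.
Variables (F : fieldType) (P : {poly F}).
Hypothesis irrP : irreducible_poly P.
Implicit Types q r : {poly F}.

Lemma irreducible_coprimep q : coprimep P q = ~~ (P %| q).
Proof.
have P1 : size P != 1%N by rewrite gtn_eqF // irrP.1.
apply/idP/idP => [cPq|].
  by apply: contra P1 => Pq; have := coprimep_dvdl Pq cPq; rewrite coprimepp.
apply: contraR => /(irrP.2 _)/(_ (dvdp_gcdl _ _))/eqp_dvdl <-.
exact: dvdp_gcdr.
Qed.

Lemma irreducible_dvdpM q r : (P %| q * r) = (P %| q) || (P %| r).
Proof.
apply/idP/orP => [Pqr|[/dvdp_mulr ->|/dvdp_mull ->] //].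
case: (boolP (P %| q)) => [|nPq]; [by left | right].
by rewrite -(Gauss_dvdpr _ (_ : coprimep P q)) // irreducible_coprimep.
Qed.

Lemma dvdp_exp_leq q i : q != 0 -> P ^+ i %| q -> (i < size q)%N.
Proof.
move=> q0 Piq; apply: leq_trans (dvdp_leq q0 Piq).
have Pi0 : P ^+ i != 0 by rewrite expf_neq0 // irredp_neq0.
rewrite -[leqRHS]prednK ?size_poly_gt0 // size_exp ltnS.
by rewrite -[leqLHS]mul1n leq_mul2r -subn1 subn_gt0 irrP.1 orbT.
Qed.

Lemma poly_ordP q i : q != 0 -> (P ^+ i %| q) = (i <= poly_ord P q)%N.
Proof.
move=> q0; have dvd_le j k : (j <= k)%N -> P ^+ k %| q -> P ^+ j %| q.
  by move=> jk; apply: dvdp_trans; apply: dvdp_exp2l.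
apply/idP/idP => [Piq|].
  exact: (@leq_bigmax_cond _ _ _ (Ordinal (dvdp_exp_leq q0 Piq))).
move=> /dvd_le; apply.
have q1 : (0 < size q)%N by rewrite size_poly_gt0.
pose A := [pred i : 'I_(size q) | P ^+ i %| q].
have [|j Pj Ej] := @eq_bigmax_cond _ A (@nat_of_ord _).
  by apply/card_gt0P; exists (Ordinal q1); rewrite inE expr0 dvd1p.
have -> : poly_ord P q = j by rewrite -Ej; apply: eq_bigl.
by move: Pj; rewrite inE.
Qed.

Lemma poly_ord_exp_mul i q : ~~ (P %| q) -> poly_ord P (P ^+ i * q) = i.
Proof.
move=> nPq; have q0 : q != 0 by apply: contraNneq nPq => ->; rewrite dvdp0.
have Pi0 : P ^+ i != 0 by rewrite expf_neq0 // irredp_neq0.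
have Piq0 : P ^+ i * q != 0 by rewrite mulf_neq0.
apply/eqP; rewrite eqn_leq -[X in _ && X]poly_ordP // dvdp_mulIl andbT leqNgt.
by rewrite -poly_ordP // exprSr dvdp_mul2l.
Qed.

Lemma poly_ord_decomp q : q != 0 ->
  exists2 q', ~~ (P %| q') & q = P ^+ poly_ord P q * q'.
Proof.
move=> q0; have : P ^+ poly_ord P q %| q by rewrite poly_ordP.
rewrite dvdp_eq mulrC => /eqP Eq; exists (q %/ P ^+ poly_ord P q) => //.
have : ~~ (P ^+ (poly_ord P q).+1 %| q) by rewrite poly_ordP // ltnn.
apply: contra => Pd; rewrite [X in _ %| X]Eq exprSr dvdp_mul2l //.
by rewrite expf_neq0 // irredp_neq0.
Qed.

Lemma poly_ordM q r : q != 0 -> r != 0 ->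
  poly_ord P (q * r) = (poly_ord P q + poly_ord P r)%N.
Proof.
move=> q0 r0; have [q' nq {1}->] := poly_ord_decomp q0.
have [r' nr {1}->] := poly_ord_decomp r0.
by rewrite mulrACA -exprD poly_ord_exp_mul // irreducible_dvdpM negb_or nq.
Qed.

Lemma poly_ordD q r : q != 0 -> r != 0 -> q + r != 0 ->
  (minn (poly_ord P q) (poly_ord P r) <= poly_ord P (q + r))%N.
Proof.
move=> q0 r0 qr0; rewrite -poly_ordP //.
by rewrite dvdp_add // poly_ordP // ?geq_minl ?geq_minr.
Qed.

End IrreducibleMultiplicity.

Section RationalFunctions.
Variable F : fieldType.
Implicit Types (x y : ratfun F) (N D q r : {poly F}).

Lemma rf_den_neq0 x : rf_den x != 0.
Proof. exact: denom_ratioP. Qed.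

Lemma rf_mul_den x : x * (rf_den x)%:F = (rf_num x)%:F.
Proof.
rewrite -{1}[x]generic_quotient.reprK; unlock FracField.tofrac.
rewrite -[LHS]FracField.pi_mul; apply/eqP; rewrite FracField.equivf_def.
rewrite /FracField.mulf !numden_Ratio ?oner_eq0 ?mulf_neq0 ?denom_ratioP ?oner_neq0 //.
by rewrite !mulr1 mulrC.
Qed.

Lemma rf_numdenE x : x = (rf_num x)%:F / (rf_den x)%:F.
Proof. by rewrite -rf_mul_den mulfK // tofrac_eq0 rf_den_neq0. Qed.

Lemma rf_num_neq0 x : x != 0 -> rf_num x != 0.
Proof.
by apply: contraNneq => nx; rewrite [x]rf_numdenE nx rmorph0 mul0r.
Qed.

Lemma rf_cross N D : D != 0 ->
  rf_num (N%:F / D%:F) * D = N * rf_den (N%:F / D%:F).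
Proof.
move=> D0; set x := _ / _; apply/eqP; rewrite -tofrac_eq !rmorphM /=.
by rewrite -rf_mul_den mulrAC /x divfK ?tofrac_eq0.
Qed.

(* Both kinds of primes come from a function [deg] on polynomials, a multiplicity
   or the opposite of the degree. *)
Variables (v : ratfun F -> int) (deg : {poly F} -> int).
Hypothesis degM : forall q r, q != 0 -> r != 0 -> deg (q * r) = deg q + deg r.
Hypothesis degD : forall q r, q != 0 -> r != 0 -> q + r != 0 ->
  Num.min (deg q) (deg r) <= deg (q + r).
Hypothesis vE : forall x, v x = deg (rf_num x) - deg (rf_den x).

Lemma val_frac N D : N != 0 -> D != 0 -> v (N%:F / D%:F) = deg N - deg D.
Proof.
move=> N0 D0; rewrite vE; have := congr1 deg (rf_cross N D0).
set x := _ / _.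
have x0 : x != 0 by rewrite mulf_neq0 ?invr_neq0 ?tofrac_eq0.
by rewrite !degM ?rf_num_neq0 ?rf_den_neq0 //; lia.
Qed.

Lemma frac_discrete_valuation :
    (exists N D, [/\ N != 0, D != 0 & deg N - deg D = 1]) ->
  discrete_valuation v.
Proof.
move=> [N [D [N0 D0 ND]]]; split=> [x y x0 y0|x y x0 y0 xy0|].
- have dx0 := rf_den_neq0 x; have dy0 := rf_den_neq0 y.
  have nx0 := rf_num_neq0 x0; have ny0 := rf_num_neq0 y0.
  have Exy : x * y = (rf_num x * rf_num y)%:F / (rf_den x * rf_den y)%:F.
    rewrite {1}[x]rf_numdenE {1}[y]rf_numdenE !rmorphM /=.
    by rewrite mulrACA -invfM.
  rewrite Exy (val_frac (mulf_neq0 nx0 ny0) (mulf_neq0 dx0 dy0)).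
  rewrite (degM nx0 ny0) (degM dx0 dy0) !vE; lia.
- have dx0 := rf_den_neq0 x; have dy0 := rf_den_neq0 y.
  have nx0 := rf_num_neq0 x0; have ny0 := rf_num_neq0 y0.
  have Exy : x + y =
      (rf_num x * rf_den y + rf_num y * rf_den x)%:F / (rf_den x * rf_den y)%:F.
    rewrite {1}[x]rf_numdenE {1}[y]rf_numdenE rmorphD !rmorphM /=.
    by rewrite addf_div ?tofrac_eq0.
  have S0 : rf_num x * rf_den y + rf_num y * rf_den x != 0.
    by apply: contraNneq xy0 => S0; rewrite Exy S0 rmorph0 mul0r.
  rewrite Exy (val_frac S0 (mulf_neq0 dx0 dy0)) !vE.
  have := degD (mulf_neq0 nx0 dy0) (mulf_neq0 ny0 dx0) S0.
  rewrite (degM nx0 dy0) (degM ny0 dx0) (degM dx0 dy0).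
  move: (deg _) (deg _) (deg _) (deg _) (deg _); clear; lia.
by exists (N%:F / D%:F); rewrite ?val_frac // mulf_neq0 ?invr_neq0 ?tofrac_eq0.
Qed.

End RationalFunctions.

Section Primes.
Variable F : fieldType.
Implicit Types N D P q : {poly F}.

Lemma finite_prime_frac P N D : irreducible_poly P -> N != 0 -> D != 0 ->
  finite_prime P (N%:F / D%:F) = (poly_ord P N)%:Z - (poly_ord P D)%:Z.
Proof.
move=> irrP; apply: (@val_frac _ _ (fun q => (poly_ord P q)%:Z)) => // q r q0 r0.
by rewrite poly_ordM.
Qed.

Lemma finite_prime_valuation P : irreducible_poly P ->
  discrete_valuation (finite_prime P).
Proof.
move=> irrP; apply: (@frac_discrete_valuation _ _ (fun q => (poly_ord P q)%:Z)).
- by move=> q r q0 r0; rewrite poly_ordM.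
- by move=> q r q0 r0 qr0; have := poly_ordD irrP q0 r0 qr0; lia.
- by [].
exists P, 1; rewrite irredp_neq0 ?oner_neq0 //; split=> //.
have P1 : ~~ (P %| 1) by rewrite dvdp1 gtn_eqF // irrP.1.
have := poly_ord_exp_mul irrP 1 P1; have := poly_ord_exp_mul irrP 0 P1.
by rewrite expr0 expr1 !mulr1 => -> ->.
Qed.

(** The opposite of the degree, for nonzero [q]. *)
Definition neg_degree q : int := 1 - (size q)%:Z.

Lemma neg_degreeM q r : q != 0 -> r != 0 -> neg_degree (q * r) = neg_degree q + neg_degree r.
Proof.
move=> q0 r0; rewrite /neg_degree size_mul //; move: q0 r0.
rewrite -!size_poly_gt0; move: (size q) (size r); clear; lia.
Qed.

Lemma infinite_primeE (x : ratfun F) :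
  infinite_prime x = neg_degree (rf_num x) - neg_degree (rf_den x).
Proof. by rewrite /infinite_prime /neg_degree; lia. Qed.

Lemma infinite_prime_frac N D : N != 0 -> D != 0 ->
  infinite_prime (N%:F / D%:F) = (size D)%:Z - (size N)%:Z.
Proof.
move=> N0 D0; rewrite (val_frac neg_degreeM infinite_primeE) // /neg_degree; lia.
Qed.

Lemma infinite_prime_valuation : discrete_valuation (@infinite_prime F).
Proof.
apply: (frac_discrete_valuation neg_degreeM _ infinite_primeE).
  move=> q r q0 r0 qr0; rewrite /neg_degree; have := size_polyD q r.
  by move: (size q) (size r) (size _); clear; lia.
by exists 1, 'X; rewrite oner_neq0 polyX_eq0 /neg_degree size_poly1 size_polyX.
Qed.

End Primes.

(** * Roots of order p over a perfect field *)

Lemma irreducible_scale (F : fieldType) (c : F) (P : {poly F}) :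
  c != 0 -> irreducible_poly P -> irreducible_poly (c *: P).
Proof.
move=> c0 [P1 irrP]; split=> [|q q1]; first by rewrite size_scale.
rewrite dvdpZr // => /(irrP q q1) qP.
by rewrite (eqp_trans qP) // eqp_sym eqp_scale.
Qed.

Lemma irreducible_factor (F : fieldType) (D : {poly F}) : (1 < size D)%N ->
  exists P, [/\ P \is monic, irreducible_poly P & P %| D].
Proof.
move=> sD; have D0 : D != 0 by rewrite -size_poly_gt0 ltnW.
pose fac m := exists P : {poly F}, [/\ (1 < size P)%N, P %| D & size P = m].
have [|m [P [sP PD Em]] Pmin] := @ex_minimal_nat fac; first by exists (size D), D.
have P0 : P != 0 by rewrite -size_poly_gt0 ltnW.
have irrP : irreducible_poly P.
  split=> // q q1 qP; have q0 : q != 0 by apply: contraTneq qP => ->; rewrite dvd0p.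
  rewrite -dvdp_size_eqp // eqn_leq dvdp_leq // Em Pmin //; exists q; split=> //.
    by rewrite ltn_neqAle eq_sym q1 size_poly_gt0.
  exact: dvdp_trans qP PD.
have lc0 : (lead_coef P)^-1 != 0 by rewrite invr_neq0 ?lead_coef_eq0.
exists ((lead_coef P)^-1 *: P); split; last by rewrite dvdpZl.
  by rewrite monicE lead_coefZ mulVf // lead_coef_eq0.
exact: irreducible_scale.
Qed.

Lemma pchar_natX (R : nzRingType) p m :
  p \in [pchar R] -> [pchar R].-nat (p ^ m)%N.
Proof. by move=> pR; rewrite pnatX pnatE ?pR // (pcharf_prime pR). Qed.

Section PerfectField.
Variables (F : fieldType) (p : nat).
Hypothesis pcharF : p \in [pchar F].
Hypothesis perfF : perfect_field F.

Let p_pr : prime p := pcharf_prime pcharF.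
Let p_gt0 : (0 < p)%N := prime_gt0 p_pr.

(** The multiplicity of an irreducible separable factor of [X^p - c], whose
    derivative vanishes, is a multiple of [p]; so the factor is linear. *)
Lemma perfect_root c : exists d : F, d ^+ p = c.
Proof.
pose q := 'X^p - c%:P : {poly F}.
have sq : size q = p.+1 by rewrite size_XnsubC.
have q0 : q != 0 by rewrite -size_poly_gt0 sq.
have [|P [monP irrP Pq]] := @irreducible_factor F q; first by rewrite sq ltnS.
have [r nPr Eq] := poly_ord_decomp irrP q0; set m := poly_ord P q in Eq.
have P0 := irredp_neq0 irrP.
have m0 : (0 < m)%N by rewrite /m -poly_ordP // expr1.
clearbody m.
have dq : q^`() = 0.
  rewrite derivB derivC subr0 derivXn -mulr_natr -polyC_natr.
  by rewrite (pcharf0 pcharF) polyC0 mulr0.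
have pm : (p %| m)%N.
  apply: contraT => npm; have mF : m%:R != 0 :> F by rewrite -(dvdn_pcharf pcharF).
  have : P ^+ m.-1 * ((P^`() * r) *+ m + P * r^`()) = 0.
    rewrite -dq Eq derivM deriv_exp -[in P ^+ m * _](prednK m0) exprS.
    by rewrite mulrDr mulrnAr mulrnAl; congr (_ *+ m + _);
      move: (P ^+ m.-1) => Pm; ring.
  move/eqP; rewrite mulf_eq0 expf_eq0 (negPf P0) andbF /= addr_eq0 => /eqP E0.
  have : P %| (P^`() * r) *+ m by rewrite E0 dvdpNr dvdp_mulIl.
  rewrite -scaler_nat dvdpZr // irreducible_dvdpM // (negPf nPr) orbF => PdP.
  by have := perfF irrP; rewrite unlock irreducible_coprimep // PdP.
have sP : size P = 2%N.
  have Pm0 : P ^+ m != 0 by rewrite expf_neq0.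
  have : (size (P ^+ m) <= size q)%N.
    by apply: dvdp_leq => //; rewrite Eq dvdp_mulIl.
  rewrite sq -[leqLHS]prednK ?size_poly_gt0 // ltnS size_exp => le_p.
  have P1 : (1 < size P)%N := irrP.1.
  have : ((size P).-1 * p <= 1 * p)%N.
    by rewrite mul1n (leq_trans _ le_p) // leq_mul2l dvdn_leq ?orbT.
  rewrite leq_pmul2r //; move: (size P) P1 => [|[|[]]] //.
have [d Pd] := poly2_root sP; exists d; apply/eqP; rewrite -subr_eq0.
have : root q d.
  by move: Pd; rewrite -!dvdp_XsubCl => Pd; apply: dvdp_trans Pd Pq.
by rewrite rootE hornerD hornerN hornerXn hornerC.
Qed.

Lemma perfect_root_expn m c : exists d : F, d ^+ (p ^ m) = c.
Proof.
elim: m c => [|m IH] c; first by exists c; rewrite expr1.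
have [d Ed] := IH c; have [b Eb] := perfect_root d.
by exists b; rewrite expnS exprM Eb.
Qed.

(** Take [p]-th roots of the coefficients; raising to the power [p] is
    additive. *)
Lemma perfect_poly_root (g : {poly F}) : exists h : {poly F}, h ^+ p = g \Po 'X^p.
Proof.
elim/poly_ind: g => [|g c [h Eh]].
  by exists 0; rewrite comp_poly0 expr0n gtn_eqF.
have [d Ed] := perfect_root c; exists (h * 'X + d%:P).
have pP : p \in [pchar {poly F}] by rewrite pchar_poly.
rewrite exprDn_pchar ?exprMn ?Eh; last by have := pchar_natX 1 pP; rewrite expn1.
by rewrite comp_polyD comp_polyM comp_polyX comp_polyC -polyC_exp Ed.
Qed.

Lemma dvdp_comp_sub (g A B : {poly F}) : A - B %| (g \Po A) - (g \Po B).
Proof.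
elim/poly_ind: g => [|g c IH]; first by rewrite !comp_poly0 subrr dvdp0.
rewrite !comp_polyD !comp_polyM !comp_polyX !comp_polyC.
have -> : (g \Po A) * A + c%:P - ((g \Po B) * B + c%:P) =
    ((g \Po A) - (g \Po B)) * A + (g \Po B) * (A - B) by ring.
by apply: dvdp_add; [apply: dvdp_mulr | apply: dvdp_mull].
Qed.

(** A separable root [z] of [P] lies in [F(z^p)], which makes [X] a [p]-th power
    modulo [P]; composing with it every polynomial is one. *)
Lemma perfect_root_mod (P Q : {poly F}) : irreducible_poly P ->
  exists M, P %| M ^+ p - Q.
Proof.
move=> irrP; have [L _ [z Pz genz]] := irredp_FAdjoin irrP.
have pL : p \in [pchar L] := rmorph_pchar (in_alg L) pcharF.
have sepz : separable_element 1 z.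
  apply/separable_elementP; exists (map_poly (in_alg L) P); split=> //.
    by apply/polyOver1P; exists P.
  by rewrite separable_map; apply: perfF.
rewrite (pcharf_p_separable 1%AS z 0 pL) expn1 in sepz.
have /Fadjoin_polyP[g0 /polyOver1P[g ->] Ez] := sepz.
have [h Eh] := perfect_poly_root g.
have Pgz : root (map_poly (in_alg L) ((g \Po 'X^p) - 'X)) z.
  rewrite rootE rmorphB /= map_comp_poly map_polyX map_polyXn hornerD hornerN.
  by rewrite horner_comp hornerX hornerXn -Ez subrr.
have Ph : P %| h ^+ p - 'X.
  rewrite Eh; apply: contraT; rewrite -irreducible_coprimep //.
  rewrite -(coprimep_map (in_alg L)) => /coprimep_root/(_ Pz).
  by rewrite -rootE Pgz.
have [Q' EQ'] := perfect_poly_root Q; exists (Q' \Po h).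
have -> : (Q' \Po h) ^+ p = Q \Po (h ^+ p).
  by rewrite -rmorphXn /= EQ' -comp_polyA comp_Xn_poly.
by rewrite -{2}[Q]comp_polyXr (dvdp_trans Ph) // dvdp_comp_sub.
Qed.

Lemma perfect_root_mod_expn m (P Q : {poly F}) : irreducible_poly P ->
  exists M, P %| M ^+ (p ^ m) - Q.
Proof.
move=> irrP; elim: m Q => [|m IH] Q.
  by exists Q; rewrite expr1 subrr dvdp0.
have [M1 PM1] := IH Q; have [M PM] := perfect_root_mod M1 irrP.
exists M; rewrite expnS exprM.
have -> : M ^+ p ^+ (p ^ m) - Q =
    (M ^+ p ^+ (p ^ m) - M1 ^+ (p ^ m)) + (M1 ^+ (p ^ m) - Q) by ring.
by rewrite dvdp_add // subrXX dvdp_mulr.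
Qed.

End PerfectField.

(** * Reduction of poles by an additive polynomial *)

(** The values of the additive polynomial with lower coefficients [c], in any
    ring; locked, so that rewriting sums does not look inside. *)
HB.lock Definition additive_map (R : nzRingType) (p n : nat) (c : nat -> R) (x : R) : R :=
  x ^+ (p ^ n) + \sum_(i < n) c i * x ^+ (p ^ i).

Section AdditiveMap.
Variables (p n : nat).

Lemma additive_mapD (R : comNzRingType) (c : nat -> R) : p \in [pchar R] ->
  {morph additive_map p n c : x y / x + y}.
Proof.
move=> pR x y; rewrite additive_map.unlock addrACA -big_split /=.
rewrite exprDn_pchar ?(pchar_natX _ pR) //; congr (_ + _).
apply: eq_bigr => i _; rewrite exprDn_pchar ?mulrDr //.
exact: pchar_natX.
Qed.

Lemma additive_map0 (R : comNzRingType) (c : nat -> R) : p \in [pchar R] ->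
  additive_map p n c 0 = 0.
Proof.
by move=> pR; apply: (addIr (additive_map p n c 0)); rewrite -additive_mapD // !add0r.
Qed.

Lemma additive_mapB (R : comNzRingType) (c : nat -> R) : p \in [pchar R] ->
  {morph additive_map p n c : x y / x - y}.
Proof.
move=> pR x y; apply: (addIr (additive_map p n c y)).
by rewrite subrK -additive_mapD // subrK.
Qed.

Lemma rmorph_additive_map (R S : nzRingType) (g : {rmorphism R -> S}) c x :
  g (additive_map p n c x) = additive_map p n (g \o c) (g x).
Proof.
rewrite additive_map.unlock rmorphD rmorph_sum rmorphXn; congr (_ + _).
by apply: eq_bigr => i _; rewrite rmorphM rmorphXn.
Qed.

(** The leading term of the additive polynomial at [M / D^b] cancels [A] up to a
    multiple of [D]; the other terms have pole order at most [a], since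
    [b * p^i < b * p^n]. *)
Lemma additive_map_pole (E : fieldType) (c : nat -> E) (A D M B : E) a b :
    (1 < p)%N -> D != 0 -> (0 < b)%N -> (b * p ^ n)%N = a.+1 ->
    A - M ^+ (p ^ n) = B * D ->
  A / D ^+ a.+1 = additive_map p n c (M / D ^+ b) +
    (B - \sum_(i < n) c i * M ^+ (p ^ i) * D ^+ (a - b * p ^ i)) / D ^+ a.
Proof.
move=> p1 D0 b0 ba AM; rewrite additive_map.unlock expr_div_n -exprM ba [X in _ + X]mulrBl.
have -> : B / D ^+ a = (A - M ^+ (p ^ n)) / D ^+ a.+1.
  by rewrite AM exprSr invfM [D ^- a * _]mulrC mulrA mulfK.
rewrite mulrBl mulr_suml [\sum_(i < n) (_ / D ^+ a)](_ : _ =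
  \sum_(i < n) c i * (M / D ^+ b) ^+ (p ^ i)); last first.
  apply: eq_bigr => i _; rewrite expr_div_n -exprM -!mulrA; congr (_ * (_ * _)).
  have ia : (b * p ^ i <= a)%N.
    by rewrite -ltnS -ba ltn_pmul2l // ltn_exp2l.
  by rewrite -{2}(subnKC ia) exprD invfM mulrCA divff ?mulr1 // expf_neq0.
by rewrite addrACA subrr addr0 addrC subrK.
Qed.

End AdditiveMap.

Definition reduced_exponent (p n alpha : nat) := exists lambda m : nat,
  [/\ alpha = (lambda * p ^ m)%N, (m < n)%N & coprime lambda p].

Lemma reduced_exponentP p n alpha : prime p -> (0 < alpha)%N ->
  ~~ (p ^ n %| alpha)%N -> reduced_exponent p n alpha.
Proof.
move=> p_pr a0; have [l cl El] := pfactor_coprime p_pr a0.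
rewrite pfactor_dvdn // -ltnNge => mn; exists l, (logn p alpha).
by split; rewrite // coprime_sym.
Qed.

Definition reduced_fraction (F : fieldType) (p n : nat) (P Q : {poly F})
    (alpha : nat) :=
  [/\ coprimep Q P, (size Q < size (P ^+ alpha))%N, (0 < alpha)%N
    & reduced_exponent p n alpha].

Section Reduction.
Variables (F : fieldType) (p n : nat) (c : nat -> F).
Hypothesis pcharF : p \in [pchar F].
Hypothesis perfF : perfect_field F.

Local Notation cst := (@rf_const F).
Local Notation f := (additive_map p n (fun i => cst (c i)) : ratfun F -> _).
Local Notation fpoly := (additive_map p n (fun i => (c i)%:P) : {poly F} -> _).

Let p_pr : prime p := pcharf_prime pcharF.
Let p_gt1 : (1 < p)%N := prime_gt1 p_pr.
Let pchar_rf : p \in [pchar (ratfun F)].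
Proof.
apply: (rmorph_pchar (@FracField.tofrac {poly F})).
exact: (rmorph_pchar (@polyC F)).
Qed.

Lemma fpoly_tofrac h : (fpoly h)%:F = f h%:F.
Proof. exact: rmorph_additive_map. Qed.

(** Poles at a single prime: as long as the pole order is a multiple of [p^n],
    the leading coefficient is a [p^n]-th power modulo [P] and can be removed. *)
Lemma reduce_at_prime (P A : {poly F}) (a : nat) : irreducible_poly P ->
  exists h Q alpha C, A%:F / P%:F ^+ a = f h + Q%:F / P%:F ^+ alpha + C%:F /\
    (Q = 0 \/ reduced_fraction p n P Q alpha).
Proof.
move=> irrP; have P0 := irredp_neq0 irrP.
have PF0 : P%:F != 0 by rewrite tofrac_eq0.
elim: a A => [|a IH] A.
  exists 0, 0, 0%N, A; split; last by left.
  by rewrite additive_map0 // rmorph0 mul0r !add0r divr1.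
have [/dvdpP[A1 EA]|nPA] := boolP (P %| A).
  have [h [Q [alpha [C [E red]]]]] := IH A1; exists h, Q, alpha, C; split=> //.
  by rewrite -E EA rmorphM /= exprS invfM mulrA mulfK.
have [/dvdnP[b ba]|npa] := boolP (p ^ n %| a.+1)%N; last first.
  have Pa0 : P ^+ a.+1 != 0 by rewrite expf_neq0.
  exists 0, (A %% P ^+ a.+1), a.+1, (A %/ P ^+ a.+1); split.
    rewrite additive_map0 // add0r {1}(divp_eq A (P ^+ a.+1)) rmorphD rmorphM /=.
    by rewrite mulrDl rmorphXn mulfK ?expf_neq0 // addrC.
  right; split=> //; last exact: reduced_exponentP.
    rewrite coprimep_sym irreducible_coprimep //; apply: contra nPA => PQ.
    rewrite (divp_eq A (P ^+ a.+1)) dvdp_add // exprSr.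
    by rewrite mulrA dvdp_mulIr.
  by rewrite ltn_modp.
have [M /dvdpP[B EM]] := perfect_root_mod_expn pcharF perfF n A irrP.
pose A' := - B - \sum_(i < n) (c i)%:P * M ^+ (p ^ i) * P ^+ (a - b * p ^ i).
have [h [Q [alpha [C [E red]]]]] := IH A'.
exists (M%:F / P%:F ^+ b + h), Q, alpha, C; split=> //.
have b0 : (0 < b)%N by move: ba; case: (b).
have EMF : A%:F - M%:F ^+ (p ^ n) = (- B)%:F * P%:F.
  by rewrite -rmorphXn -rmorphB -rmorphM mulNr -EM opprB.
rewrite -addrA in E; rewrite additive_mapD // -!addrA -E.
rewrite (additive_map_pole (fun i => cst (c i)) p_gt1 PF0 b0 (esym ba) EMF).
congr (_ + _ / _); rewrite /A' rmorphB rmorph_sum; congr (_ - _).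
by apply: eq_bigr => i _; rewrite !rmorphM !rmorphXn.
Qed.

Definition is_const_poly (R : {poly F}) := exists e : F, R = e%:P.

Definition reduced_polynomial (R : {poly F}) :=
  (~ is_const_poly R ->
     exists lambda m : nat, [/\ size R = (lambda * p ^ m).+1,
       (0 < lambda * p ^ m)%N, (m < n)%N & coprime lambda p]) /\
  (is_const_poly R -> R = 0 \/ ~ exists d, R = (additive_map p n c d)%:P).

(** At infinity the leading coefficient itself is a [p^n]-th power, so the degree
    can be lowered as long as it is a multiple of [p^n]. *)
Lemma reduce_polynomial C : exists h R, C = fpoly h + R /\ reduced_polynomial R.
Proof.
have [m] := ubnP (size C); elim: m C => // m IH C sC.
have pP : p \in [pchar {poly F}] by rewrite pchar_poly.
have [[e Ce]|nC] := boolp.pselect (is_const_poly C).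
  have [[d Cd]|nd] := boolp.pselect (exists d, C = (additive_map p n c d)%:P).
    exists d%:P, 0; rewrite addr0; split; last first.
      by split=> [[]|_]; [exists 0; rewrite polyC0 | left].
    by rewrite Cd (rmorph_additive_map p n (@polyC F)).
  exists 0, C; rewrite additive_map0 // add0r; split=> //.
  by split=> [[]|_]; [exists e | right].
have sC1 : (1 < size C)%N.
  by rewrite ltnNge; apply/negP => /size1_polyC C1; apply: nC; exists C`_0.
have sC' : size C = (size C).-1.+1 by rewrite prednK // ltnW.
have [/dvdnP[b Eb]|npC] := boolP (p ^ n %| (size C).-1)%N; last first.
  exists 0, C; rewrite additive_map0 // add0r; split=> //; split=> // _.
  have [|l [k [El kn clp]]] := reduced_exponentP p_pr _ npC.
    by rewrite -ltnS -sC'.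
  by exists l, k; rewrite sC' -El -ltnS -sC'.
have b0 : (0 < b)%N by case: (b) Eb => // Eb; move: sC1; rewrite sC' Eb.
have [d Ed] := perfect_root_expn pcharF perfF n (lead_coef C).
pose t : {poly F} := d *: 'X^b.
have [|h [R [E red]]] := IH (C - fpoly t); last first.
  by exists (t + h), R; rewrite additive_mapD // -addrA -E addrC subrK.
have st k : t ^+ k = d ^+ k *: 'X^(b * k) by rewrite exprZn exprM.
rewrite -ltnS; apply: leq_trans sC; rewrite ltnS sC' ltnS.
apply/leq_sizeP => j Cj; rewrite coefB additive_map.unlock coefD st Ed coefZ coefXn -Eb coef_sum.
rewrite big1 => [|i _]; last first.
  rewrite st coefCM coefZ coefXn gtn_eqF ?mulr0 // (leq_trans _ Cj) // Eb.
  by rewrite ltn_pmul2l // ltn_exp2l.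
rewrite addr0; have [->|nj] := eqVneq j (size C).-1.
  by rewrite mulr1 -lead_coefE subrr.
by rewrite mulr0 subr0 nth_default // leq_neq_predn.
Qed.

(** The triple [(P, Q, alpha)] stands for the fraction [Q / P^alpha]. *)
Definition fraction_term (t : {poly F} * {poly F} * nat) : ratfun F :=
  t.1.2%:F / t.1.1%:F ^+ t.2.

Definition reduced_term (t : {poly F} * {poly F} * nat) :=
  [/\ t.1.1 \is monic, irreducible_poly t.1.1
    & reduced_fraction p n t.1.1 t.1.2 t.2].

(** Partial fractions, one prime of the denominator at a time: the correction at
    [P] has no pole elsewhere, so it does not disturb the other primes. *)
Lemma reduce_fractions (D N : {poly F}) : D != 0 ->
  exists h (s : seq ({poly F} * {poly F} * nat)) C,
    [/\ N%:F / D%:F = f h + \sum_(t <- s) fraction_term t + C%:F,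
        uniq [seq t.1.1 | t <- s]
      & forall t, t \in s -> reduced_term t /\ t.1.1 %| D].
Proof.
have [m] := ubnP (size D); elim: m D N => // m IH D N sD D0.
have [sD1|sD1] := leqP (size D) 1.
  exists 0, [::], ((D`_0)^-1 *: N); split=> //.
  have ED := size1_polyC sD1; have d0 : D`_0 != 0 by rewrite -polyC_eq0 -ED.
  rewrite big_nil additive_map0 // !add0r [in LHS]ED.
  apply: (mulIf (_ : (D`_0)%:P%:F != 0)); first by rewrite tofrac_eq0 polyC_eq0.
  rewrite divfK ?tofrac_eq0 ?polyC_eq0 // -rmorphM -mul_polyC mulrAC -polyCM.
  by rewrite mulVf // mul1r.
have [P [monP irrP PD]] := irreducible_factor sD1.
have P0 := irredp_neq0 irrP.
have [D' nPD' ED] := poly_ord_decomp irrP D0; set a := poly_ord P D in ED.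
have a0 : (0 < a)%N by rewrite /a -poly_ordP // expr1.
clearbody a.
have D'0 : D' != 0 by apply: contraNneq nPD' => ->; rewrite dvdp0.
have Pa0 : P ^+ a != 0 by rewrite expf_neq0.
have sD' : (size D' < size D)%N.
  have sPa : (1 < size (P ^+ a))%N.
    have := irrP.1; rewrite -[(size (P ^+ a))]prednK ?size_poly_gt0 // size_exp.
    by rewrite ltnS muln_gt0 a0 andbT -subn1 subn_gt0.
  rewrite ED size_mul //; move: sPa; rewrite -size_poly_gt0 in D'0.
  by move: D'0; case: (size (P ^+ a)) => [|[|k]] // _ _; rewrite !addSn /= ltnS leq_addl.
have /Bezout_eq1_coprimepP[[u1 u2] /= Eu] : coprimep (P ^+ a) D'.
  by rewrite coprimep_expl // irreducible_coprimep.
have [h1 [Q [alpha [C1 [E1 red1]]]]] := reduce_at_prime (N * u2) a irrP.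
have [|h2 [s [C2 [E2 us red2]]]] := IH D' (N * u1) _ D'0; first exact: leq_trans sD' sD.
have END : N%:F / D%:F = (N * u2)%:F / P%:F ^+ a + (N * u1)%:F / D'%:F.
  rewrite -rmorphXn addf_div ?tofrac_eq0 // -!rmorphM -rmorphD /= -ED.
  congr (_%:F / _); rewrite -[LHS]mulr1 -Eu; ring.
have red2' t : t \in s -> reduced_term t /\ t.1.1 %| D.
  by move=> /red2[? tD']; split=> //; rewrite ED dvdp_mull.
case: red1 => [Q0|red1].
  exists (h1 + h2), s, (C1 + C2); split=> //.
  rewrite END E1 E2 Q0 rmorph0 mul0r addr0 additive_mapD // rmorphD /=.
  by rewrite addrACA -!addrA; congr (_ + (_ + _)); rewrite addrC.
exists (h1 + h2), ((P, Q, alpha) :: s), (C1 + C2); split.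
- rewrite END E1 E2 big_cons additive_mapD // rmorphD /=.
  rewrite addrACA; congr (_ + _); rewrite addrACA; congr (_ + _).
- rewrite /= us andbT; apply: contra nPD' => /mapP[t /red2[_ tD'] /= ->] //.
by move=> t; rewrite inE => /orP[/eqP->|/red2' //].
Qed.

Lemma normal_form (u : ratfun F) :
  exists h (s : seq ({poly F} * {poly F} * nat)) R,
    [/\ u - f h = \sum_(t <- s) fraction_term t + R%:F,
        uniq [seq t.1.1 | t <- s], forall t, t \in s -> reduced_term t
      & reduced_polynomial R].
Proof.
have [h [s [C [E us red]]]] := reduce_fractions (rf_num u) (rf_den_neq0 u).
have [g [R [EC redR]]] := reduce_polynomial C.
exists (h + g%:F), s, R; split=> // [|t /red[] //].
rewrite additive_mapD // {1}[u]rf_numdenE E EC rmorphD /= fpoly_tofrac.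
by rewrite addrACA [LHS]addrC addKr.
Qed.

End Reduction.

(** * Ramification and the normal form *)

HB.instance Definition _ (F : fieldType) :=
  GRing.RMorphism.copy (@rf_const F) (@FracField.tofrac {poly F} \o @polyC F).

Section AdditivePolynomial.
Variables (F : fieldType) (p n : nat) (a : nat -> F).

Definition additive_polynomial : {poly F} :=
  'X^(p ^ n) + \sum_(i < n) a i *: 'X^(p ^ i).

Local Notation f := additive_polynomial.

Lemma horner_map_additive (R : comNzRingType) (g : {rmorphism F -> R}) x :
  (map_poly g f).[x] = additive_map p n (g \o a) x.
Proof.
rewrite additive_map.unlock rmorphD rmorph_sum /= map_polyXn hornerD hornerXn.
rewrite horner_sum; congr (_ + _); apply: eq_bigr => i _.
by rewrite map_polyZ map_polyXn hornerZ hornerXn.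
Qed.

Lemma horner_additive x : f.[x] = additive_map p n a x.
Proof.
by have := horner_map_additive (@idfun F) x; rewrite map_poly_id.
Qed.

Hypothesis p_gt1 : (1 < p)%N.

Lemma size_additive : size f = (p ^ n).+1.
Proof.
rewrite /f size_polyDl size_polyXn // ltnS.
apply: leq_trans (size_sum _ _ _) _; apply/bigmax_leqP => i _.
apply: leq_trans (size_scale_leq _ _) _.
by rewrite size_polyXn ltn_exp2l.
Qed.

Lemma additive_monic : f \is monic.
Proof.
rewrite monicE /lead_coef size_additive /= coefD coefXn eqxx coef_sum.
rewrite big1 ?addr0 // => i _.
by rewrite coefZ coefXn gtn_eqF ?mulr0 // ltn_exp2l.
Qed.

(** All exponents [p^i] with [0 < i] vanish in [F], which leaves the linear term;
    its coefficient is [a 0], or 1 when [n = 0]. *)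
Lemma deriv_additive : p \in [pchar F] -> a 0%N != 0 ->
  exists2 e, e != 0 & f^`() = e%:P.
Proof.
move=> pF a0; have d0 i : (0 < i)%N -> ('X^(p ^ i) : {poly F})^`() = 0.
  case: i => // i _; rewrite derivXn expnS mulrnA.
  have pP : p \in [pchar {poly F}] by rewrite pchar_poly.
  by rewrite (mulrn_pchar pP) mul0rn.
have [n0|n_gt0] := posnP n.
  by exists 1; rewrite ?oner_neq0 // /f n0 big_ord0 addr0 expn0 derivX.
exists (a 0%N) => //; rewrite /f derivD d0 // add0r raddf_sum /=.
case: n n_gt0 => // k _; rewrite big_ord_recl big1 => [|i _]; last first.
  by rewrite derivZ d0 ?scaler0.
by rewrite addr0 derivZ expn0 derivX alg_polyC.
Qed.

End AdditivePolynomial.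

Section Ramification.
Variables (k0 : fieldType) (p n : nat) (a : nat -> k0).
Variables (K : splittingFieldType (ratfun k0)) (z : K) (w : ratfun k0).
Hypothesis pchar_k0 : p \in [pchar k0].
Variable v : valuation (ratfun k0).
Hypothesis v_const : forall c, rf_const c \in vring v.

Local Notation f := (additive_polynomial p n a).
Hypothesis fz : (map_poly (in_alg K) (map_poly (@rf_const k0) f)).[z] = w%:A.

Let p_pr : prime p := pcharf_prime pchar_k0.
Let p_gt1 : (1 < p)%N := prime_gt1 p_pr.

Lemma const_polyOver (q : {poly k0}) :
  map_poly (@rf_const k0) q \is a polyOver (vring v).
Proof. by apply/polyOverP => i; rewrite coef_map v_const. Qed.

(** The derivative of [f(X) - w] is a nonzero constant, hence a unit at every
    prime. *)
Lemma unramified_at : a 0%N != 0 -> <<1; z>>%VS = fullv -> w \in vring v ->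
  ~ ramified K v.
Proof.
move=> a0 genz Ow; pose G := map_poly (@rf_const k0) f - w%:P.
have [e e0 Ef] := deriv_additive n pchar_k0 a0.
apply: (@unramified_of_separable _ K v z G) => //.
- rewrite monicE lead_coefDl; first by rewrite -monicE monic_map ?additive_monic.
  rewrite size_polyN size_polyC size_map_poly size_additive //.
  by rewrite (leq_ltn_trans (leq_b1 _)) // ltnS expn_gt0 ltnW.
- by rewrite rpredB ?const_polyOver // polyOverC.
- rewrite rmorphB /= [horner_alg z w%:P]horner_algC.
  by rewrite [X in X - _](fz : _ = w%:A) subrr.
move=> W r Wr r0; rewrite derivB derivC subr0 deriv_map Ef map_polyC /=.
rewrite horner_algC; apply: contra (one_notin_vmax W) => We.
have -> : 1 = (rf_const e^-1)%:A * (rf_const e)%:A :> K.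
  by rewrite -scalerAl mul1r scalerA -rmorphM /= mulVf // rmorph1 scale1r.
by apply: vmaxMl We; apply: map_in_alg_vring Wr (v_const e^-1).
Qed.

(** Comparing values in [f(z) = w] gives [p^n * W z = - e * lambda * p^m], hence
    [p] divides [e]. *)
Lemma ramified_at lambda m : (0 < lambda)%N -> (m < n)%N -> coprime lambda p ->
  w != 0 -> v w = - (lambda * p ^ m)%:Z -> ramified K v.
Proof.
move=> l0 mn clp w0 vw; have [W [e [We e0]]] := valuation_extension K v.
exists W, e; split=> //; first exact: valuationP.
pose g := map_poly (in_alg K) (map_poly (@rf_const k0) f).
have Og : g \is a polyOver (vring W).
  apply/polyOverP => i; rewrite coef_map.
  exact: (map_in_alg_vring We (polyOverP (const_polyOver f) i)).
have wA0 : w%:A != 0 :> K by rewrite scaler_eq0 oner_eq0 orbF.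
have a_gt0 : (0 < lambda * p ^ m)%N by rewrite muln_gt0 l0 expn_gt0 ltnW.
have Ww : W w%:A = - (lambda * p ^ m * e)%:Z.
  by rewrite We // vw -mulr_natr natz PoszM mulNr.
have : z \notin vring W.
  apply: contraTN isT => Oz; have := rpred_horner Og Oz.
  rewrite fz vringE (negPf wA0) Ww /= oppr_ge0 lez_nat leqn0 muln_eq0.
  by rewrite !gtn_eqF.
rewrite vringE negb_or -ltNge => /andP[z0 Wz].
have mong : g \is monic by rewrite !monic_map // additive_monic.
have [_] := val_monic_horner_pole mong Og z0 Wz.
rewrite fz Ww !size_map_poly size_additive //= -mulr_natr natz => EW.
have {}EW : (lambda * p ^ m * e = `|W z| * p ^ n)%N.
  by have := congr1 absz EW; rewrite abszN abszM.
have pe : (p %| lambda * e)%N.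
  have pm0 : (0 < p ^ m)%N by rewrite expn_gt0 ltnW.
  have pm : (p * p ^ m %| p ^ n)%N by rewrite -expnS dvdn_exp2l.
  have := dvdn_mull `|W z|%N pm; rewrite -EW mulnAC.
  by rewrite dvdn_pmul2r.
rewrite Gauss_dvdr 1?coprime_sym // in pe.
exact: leq_trans p_gt1 (dvdn_leq e0 pe).
Qed.

End Ramification.

Section ValuesOfNormalForms.
Variables (k0 : fieldType) (p n : nat).
Implicit Types (P Q R N D : {poly k0}) (s : seq ({poly k0} * {poly k0} * nat)).

Definition finite_valuation P (irrP : irreducible_poly P) :=
  Valuation (finite_prime_valuation irrP).

Definition infinite_valuation := Valuation (infinite_prime_valuation k0).

Lemma finite_vring P (irrP : irreducible_poly P) N D : ~~ (P %| D) ->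
  N%:F / D%:F \in vring (finite_valuation irrP).
Proof.
move=> nPD; have D0 : D != 0 by apply: contraNneq nPD => ->; rewrite dvdp0.
have [->|N0] := eqVneq N 0; first by rewrite rmorph0 mul0r rpred0.
rewrite vringE /= finite_prime_frac //.
by have := poly_ord_exp_mul irrP 0 nPD; rewrite mul1r => ->; rewrite subr0 orbT.
Qed.

Lemma finite_vring_poly P (irrP : irreducible_poly P) N :
  N%:F \in vring (finite_valuation irrP).
Proof.
rewrite -[N%:F]divr1 -(rmorph1 (@FracField.tofrac {poly k0})).
by rewrite finite_vring // dvdp1 gtn_eqF // irrP.1.
Qed.

Lemma monic_irreducible_dvdp_exp P P' m : P \is monic -> P' \is monic ->
  irreducible_poly P -> irreducible_poly P' -> P' %| P ^+ m -> P' = P.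
Proof.
move=> mP mP' irrP irrP'; have [<-//|nPP'] := eqVneq P' P => P'Pm.
have : ~~ coprimep P' (P ^+ m) by rewrite irreducible_coprimep // P'Pm.
case/negP; apply: coprimep_expr; rewrite irreducible_coprimep //.
apply: contra nPP' => /(irrP.2 P'); rewrite eqp_monic // => -> //.
by rewrite gtn_eqF // irrP'.1.
Qed.

Lemma finite_vring_term P (irrP : irreducible_poly P) t : P \is monic ->
  reduced_term p n t -> t.1.1 != P ->
  fraction_term t \in vring (finite_valuation irrP).
Proof.
move=> monP [mont irrt _] tP; rewrite /fraction_term -rmorphXn finite_vring //.
apply: contra tP => /(monic_irreducible_dvdp_exp mont monP irrt irrP) ->.
exact: eqxx.
Qed.

Lemma finite_vring_normal_form P (irrP : irreducible_poly P) s R :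
    P \is monic -> (forall t, t \in s -> reduced_term p n t) ->
    P \notin [seq t.1.1 | t <- s] ->
  \sum_(t <- s) fraction_term t + R%:F \in vring (finite_valuation irrP).
Proof.
move=> monP red nPs; rewrite rpredD ?finite_vring_poly //.
rewrite big_seq rpred_sum // => t ts; apply: finite_vring_term => //.
  exact: red.
by apply: contraNneq nPs => <-; apply: map_f.
Qed.

(** Only one term has a pole at its own prime, by distinctness of the primes; it
    dominates the sum. *)
Lemma finite_pole_normal_form t (irrP : irreducible_poly t.1.1) s R :
    (forall t, t \in s -> reduced_term p n t) -> t \in s ->
    uniq [seq t.1.1 | t <- s] ->
  let w := \sum_(t <- s) fraction_term t + R%:F in
  w != 0 /\ finite_valuation irrP w = - (t.2)%:Z.
Proof.
move=> red ts us w; have [monP _ [cQP _ a0 _]] := red t ts.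
have Q0 : t.1.2 != 0.
  by apply: contraTneq cQP => ->; rewrite coprime0p -size_poly_eq1
    gtn_eqF // irrP.1.
have nPQ : ~~ (t.1.1 %| t.1.2) by rewrite -irreducible_coprimep // coprimep_sym.
have Pa0 : t.1.1 ^+ t.2 != 0 by rewrite expf_neq0 // irredp_neq0.
have t0 : fraction_term t != 0.
  by rewrite /fraction_term -rmorphXn mulf_neq0 ?invr_neq0 ?tofrac_eq0.
have vt : finite_valuation irrP (fraction_term t) = - (t.2)%:Z.
  rewrite /fraction_term -rmorphXn /= finite_prime_frac //.
  have nP1 : ~~ (t.1.1 %| 1) by rewrite dvdp1 gtn_eqF // irrP.1.
  have := poly_ord_exp_mul irrP 0 nPQ; have := poly_ord_exp_mul irrP t.2 nP1.
  by rewrite mulr1 mul1r => -> ->; rewrite sub0r.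
pose s' := rem t s.
have Ew : w = fraction_term t + (\sum_(t <- s') fraction_term t + R%:F).
  by rewrite /w (perm_big _ (perm_to_rem ts)) big_cons -addrA.
have Os' : \sum_(t <- s') fraction_term t + R%:F \in vring (finite_valuation irrP).
  apply: finite_vring_normal_form => // [t' /mem_rem/red //|].
  have := us; rewrite (perm_uniq (perm_map _ (perm_to_rem ts))) /=.
  by case/andP.
have [|nz Ev] := @val_dominant _ (finite_valuation irrP) (fraction_term t)
  (\sum_(t <- s') fraction_term t + R%:F) t0; last by rewrite Ew Ev vt.
apply: vmaxMl Os' _; rewrite vmaxE (valV _ t0) vt opprK.
by apply/orP; right; rewrite ltz_nat.
Qed.

Lemma infinite_poly R : R != 0 -> infinite_valuation R%:F = 1 - (size R)%:Z.
Proof.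
move=> R0; rewrite /= -[R%:F]divr1 -(rmorph1 (@FracField.tofrac {poly k0})).
by rewrite infinite_prime_frac ?oner_neq0 // size_poly1.
Qed.

(** A proper fraction vanishes at infinity. *)
Lemma infinite_vmax_term t : reduced_term p n t ->
  fraction_term t \in vmax infinite_valuation.
Proof.
move=> [_ irrt [_ sQ _ _]]; rewrite vmaxE.
have [Q0|Q0] := eqVneq t.1.2 0.
  by rewrite /fraction_term Q0 rmorph0 mul0r eqxx.
rewrite /fraction_term -rmorphXn /= infinite_prime_frac ?subr_gt0 ?ltz_nat ?sQ ?orbT //.
by rewrite expf_neq0 // irredp_neq0.
Qed.

Lemma infinite_vmax_terms s : (forall t, t \in s -> reduced_term p n t) ->
  \sum_(t <- s) fraction_term t \in vmax infinite_valuation.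
Proof.
by move=> red; rewrite big_seq rpred_sum // => t ts; apply/infinite_vmax_term/red.
Qed.

Lemma infinite_vring_const c : rf_const c \in vring infinite_valuation.
Proof.
have [->|c0] := eqVneq c 0; first by rewrite rmorph0 rpred0.
rewrite vringE /rf_const infinite_poly ?polyC_eq0 // size_polyC c0 subrr.
by rewrite lexx orbT.
Qed.

Lemma infinite_pole_normal_form s R :
    (forall t, t \in s -> reduced_term p n t) -> (1 < size R)%N ->
  let w := \sum_(t <- s) fraction_term t + R%:F in
  w != 0 /\ infinite_valuation w = - ((size R).-1)%:Z.
Proof.
move=> red sR w; have R0 : R != 0 by rewrite -size_poly_gt0 ltnW.
have RF0 : R%:F != 0 by rewrite tofrac_eq0.
have vR : infinite_valuation R%:F = - ((size R).-1)%:Z.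
  by rewrite infinite_poly // -[in LHS](ltn_predK sR); lia.
rewrite /w addrC; have [|nz ->] := @val_dominant _ infinite_valuation R%:F
  (\sum_(t <- s) fraction_term t) RF0; last by rewrite nz.
rewrite mulrC vmaxMl ?infinite_vmax_terms //.
by rewrite vringE valV // vR opprK orbT.
Qed.

End ValuesOfNormalForms.

Theorem theorem5p3 (k0 : fieldType) (p n : nat) (a : nat -> k0)
    (f : {poly k0}) (K : splittingFieldType (ratfun k0)) (y : K)
    (u : ratfun k0) :
  p \in [pchar k0] ->
  perfect_field k0 ->
  f = 'X^(p ^ n) + \sum_(i < n) a i *: 'X^(p ^ i) ->
  a 0%N != 0 ->
  additive_poly f ->
  splits f ->
  <<1; y>>%VS = fullv ->
  galois 1%AS (fullv : {vspace K}) ->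
  (p.-abelem 'Gal((fullv : {vspace K}) / 1%AS))%g ->
  (map_poly (in_alg K) (map_poly (@rf_const k0) f)).[y] = u%:A ->
  irreducible_poly (map_poly (@rf_const k0) f - u%:P) ->
  size (map_poly (@rf_const k0) f - u%:P) = (p ^ n).+1 ->
  exists (z : K) (w : ratfun k0),
    [/\ <<1; z>>%VS = fullv,
        (map_poly (in_alg K) (map_poly (@rf_const k0) f)).[z] = w%:A
      & exists (r : nat) (P Q : 'I_r -> {poly k0}) (alpha : 'I_r -> nat)
               (R : {poly k0}),
        [/\ [/\ w = \sum_(i < r) (Q i)%:F / (P i)%:F ^+ alpha i + R%:F,
                injective P
              & forall i, P i \is monic /\ irreducible_poly (P i)],
            forall i,
              [/\ coprimep (Q i) (P i),
                  (size (Q i) < size (P i ^+ alpha i))%N,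
                  (0 < alpha i)%N
                & exists lambda m : nat,
                    [/\ alpha i = (lambda * p ^ m)%N, (m < n)%N
                      & coprime lambda p]],
            ~ (exists c : k0, R = c%:P) ->
              exists lambda m : nat,
                [/\ size R = (lambda * p ^ m).+1, (0 < lambda * p ^ m)%N,
                    (m < n)%N & coprime lambda p],
            (exists c : k0, R = c%:P) ->
              R = 0 \/ ~ (exists delta : k0, R = f.[delta]%:P)
          & (forall P' : {poly k0}, P' \is monic -> irreducible_poly P' ->
               (ramified K (finite_prime P') <-> exists i, P i = P'))
            /\ (ramified K (@infinite_prime k0) <->
                ~ (exists c : k0, R = c%:P))]].
Proof.
move=> pk0 perf Ef a0 _ _ geny _ _ fy _ _.
have p_gt1 := prime_gt1 (pcharf_prime pk0).
have [h [s [R [Ew us red [redR constR]]]]] := normal_form n a pk0 perf u.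
have {}Ef : f = additive_polynomial p n a by [].
set w := u - _ in Ew; pose z := y - h%:A.
have genz : <<1; z>>%VS = fullv.
  apply/eqP; rewrite eqEsubv subvf -geny; apply/FadjoinP; split.
    exact: subv_adjoin.
  have -> : y = z + h%:A by rewrite subrK.
  by rewrite rpredD ?memv_adjoin // (subvP (subv_adjoin _ _)) // rpredZ // mem1v.
have pK : p \in [pchar K].
  apply: (rmorph_pchar (in_alg K)).
  exact: (rmorph_pchar (@rf_const k0)).
have fz : (map_poly (in_alg K) (map_poly (@rf_const k0) f)).[z] = w%:A.
  move: fy; rewrite Ef -!map_poly_comp !(horner_map_additive _ _ _ (in_alg K \o @rf_const k0)).
  rewrite additive_mapB // => ->; rewrite /w scalerBl; congr (_ - _).
  by rewrite -[RHS]/(in_alg K _) rmorph_additive_map.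
exists z, w; split=> //.
rewrite {}Ef in fz *.
pose t (i : 'I_(size s)) := tnth (in_tuple s) i.
have ts i : t i \in s by apply: mem_tnth.
have tP P : P \in [seq t.1.1 | t <- s] -> exists i, (t i).1.1 = P.
  move=> /mapP[t' /(tnthP (in_tuple s))[i ->] ->]; by exists i.
exists (size s), (fun i => (t i).1.1), (fun i => (t i).1.2), (fun i => (t i).2), R.
split=> //.
- split; first by rewrite Ew big_tnth.
    move=> i j Pij; apply/val_inj/eqP.
    rewrite -(nth_uniq 0 _ _ us) ?size_map ?ltn_ord //=.
    have tE k : nth (t i) s (k : 'I_(size s)) = t k.
      exact: esym (tnth_nth (t i) (in_tuple s) k).
    by rewrite !(nth_map (t i)) // !tE Pij.
  by move=> i; have [] := red _ (ts i).
- by move=> i; have [] := red _ (ts i).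
- by move=> /constR[->|nR]; [left | right=> -[d Rd]; apply: nR; exists d;
    rewrite -horner_additive].
split=> [P' monP' irrP'|].
  have v_const c : rf_const c \in vring (finite_valuation irrP').
    exact: finite_vring_poly.
  split=> [ram|[i Pi]].
    apply: tP; apply: contraPT ram => nP's.
    apply: (unramified_at (v := finite_valuation irrP') pk0 v_const fz) => //.
    by rewrite Ew; apply: finite_vring_normal_form red nP's.
  have [_ _ [_ _ al0 [l [m [El mn cl]]]]] := red _ (ts i).
  subst P'.
  have [w0 vw] := finite_pole_normal_form irrP' R red (ts i) us.
  rewrite -Ew El in w0 vw al0.
  apply: (ramified_at (v := finite_valuation irrP') pk0 v_const fz _ mn cl w0 vw).
  by move: al0; rewrite muln_gt0 => /andP[].
have v_const := @infinite_vring_const k0.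
split=> [ram [c Rc]|nR].
  apply: (unramified_at (v := infinite_valuation k0) pk0 v_const fz) ram => //.
  rewrite Ew rpredD //; first exact/vmax_vring/(infinite_vmax_terms red).
  by rewrite Rc; apply: infinite_vring_const.
have [l [m [sR lm0 mn cl]]] := redR nR.
have [|w0 vw] := infinite_pole_normal_form (R := R) red; first by rewrite sR ltnS.
rewrite -Ew sR in w0 vw.
apply: (ramified_at (v := infinite_valuation k0) pk0 v_const fz _ mn cl w0 vw).
by move: lm0; rewrite muln_gt0 => /andP[].
Qed.
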